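(* Suppose that $D>d$ are positive integers and let $A,B$ be any nontrivial finite alphabets. Let $\mathcal{G}_d=\mathrm{Aut}(A^{\mathbb{Z}^d})$ and $\mathcal{G}_D=\mathrm{Aut}(B^{\mathbb{Z}^D})$. Then $\mathcal{G}_D$ has a finitely generated subgroup $\mathcal{G}$ such that for all central subgroups $K\le\mathcal{G}_D$ and $K'\le\mathcal{G}_d$, the image $\mathcal{G}K/K$ of $\mathcal{G}$ in $\mathcal{G}_D/K$ does not embed in $\mathcal{G}_d/K'$.
   Context: An alphabet is a finite set; it is nontrivial if it has at least two elements. For a countable group $G$, $A^G$ has the product topology and the continuous $G$-action $(gx)_h=x_{g^{-1}h}$; $\mathrm{Aut}(A^G)$ is the group (under composition) of $G$-equivariant homeomorphisms $A^G\to A^G$. A central subgroup is a subgroup contained in the center. ''Embeds'' means as an abstract group, via an injective homomorphism. *)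

(* Defs.v *)
From HB Require Import structures.
From mathcomp Require Import all_boot ssralg ssrint matrix.
From mathcomp Require Import generic_quotient.
From mathcomp Require Import boolp classical_sets functions cardinality.
From mathcomp Require Import topology function_spaces.

Set Implicit Arguments.
Unset Strict Implicit.
Unset Printing Implicit Defensive.

Import GRing.Theory.
Local Open Scope classical_set_scope.
Local Open Scope quotient_scope.
Local Open Scope group_scope.

Section Subgroups.
Variable G : groupType.

Definition subgroup (H : set G) : Prop := group_closed (mem H).

Definition generated (S : set G) : set G := smallest subgroup S.

Lemma subgroup_generated (S : set G) : subgroup (generated S).
Proof.
split; first by apply/mem_set => H [[H1 _] _]; exact: set_mem H1.
move=> x y /set_mem xS /set_mem yS; apply/mem_set => H [sH SH].
by apply/set_mem/sH.2; apply/mem_set; [exact: xS | exact: yS].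
Qed.

Definition fg_subgroup (H : set G) : Prop :=
  exists2 S : set G, finite_set S & H = generated S.

Definition center : set G := [set x | forall y, commute x y].

Record normalSubgroup := NormalSubgroup {
  normal_set :> set G;
  normal_subgroup : subgroup normal_set;
  normal_conj : forall x y, normal_set x -> normal_set (x ^ y) }.

Record centralSubgroup := CentralSubgroup {
  central_set : set G;
  central_subgroup : subgroup central_set;
  central_center : central_set `<=` center }.

Lemma central_conj (K : centralSubgroup) x y :
  central_set K x -> central_set K (x ^ y).
Proof. by move=> Kx; rewrite conjgE (central_center Kx y) mulKg. Qed.

Definition normal_of_central (K : centralSubgroup) : normalSubgroup :=
  NormalSubgroup (@central_subgroup K) (@central_conj K).

End Subgroups.

Arguments center : clear implicits.
Coercion normal_of_central : centralSubgroup >-> normalSubgroup.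

Section QuotientGroup.
Variables (G : groupType) (K : normalSubgroup G).

Definition coset_eq : rel G := fun x y => x^-1 * y \in (K : set G).

Let K1 : 1 \in (K : set G).
Proof. exact: (normal_subgroup K).1. Qed.

Let KM x y : x \in (K : set G) -> y \in (K : set G) -> x * y \in (K : set G).
Proof. exact: (group_closedM (normal_subgroup K)). Qed.

Let KV x : x \in (K : set G) -> x^-1 \in (K : set G).
Proof. exact: (group_closedV (normal_subgroup K)). Qed.

Let KJ x y : x \in (K : set G) -> x ^ y \in (K : set G).
Proof. by move=> /set_mem Kx; apply/mem_set/normal_conj. Qed.

Lemma coset_eq_refl : reflexive coset_eq.
Proof. by move=> x; rewrite /coset_eq mulVg. Qed.

Lemma coset_eq_sym : symmetric coset_eq.
Proof.
by move=> x y; apply/idP/idP => /KV; rewrite /coset_eq invgM invgK.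
Qed.

Lemma coset_eq_trans : transitive coset_eq.
Proof.
by move=> y x z xy yz; have := KM xy yz; rewrite mulgA mulgK.
Qed.

Canonical coset_equiv :=
  EquivRel coset_eq coset_eq_refl coset_eq_sym coset_eq_trans.

Definition quotient_group : Type := {eq_quot coset_eq}.
HB.instance Definition _ := Choice.on quotient_group.
HB.instance Definition _ := EqQuotient.on quotient_group.

Definition coset (x : G) : quotient_group := \pi x.

Lemma coset_eqP x y : coset x = coset y <-> x^-1 * y \in (K : set G).
Proof. by split=> [/eqP|h]; [|apply/eqP]; rewrite /coset piE. Qed.

Definition quot_one : quotient_group := coset 1.
Definition quot_mul (u v : quotient_group) : quotient_group :=
  coset (repr u * repr v).
Definition quot_inv (u : quotient_group) : quotient_group :=
  coset (repr u)^-1.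

Lemma coset_repr u : coset (repr u) = u.
Proof. exact: reprK. Qed.

Lemma quot_mulE x y : quot_mul (coset x) (coset y) = coset (x * y).
Proof.
have /coset_eqP Kx := coset_repr (coset x).
have /coset_eqP Ky := coset_repr (coset y).
set a := repr _ in Kx *; set b := repr _ in Ky *.
apply/coset_eqP; rewrite invgM.
have := KM (KJ b Kx) Ky.
by rewrite conjgE !mulgA mulgK.
Qed.

Lemma quot_mulA : associative quot_mul.
Proof.
move=> u v w; rewrite -(coset_repr u) -(coset_repr v) -(coset_repr w).
by rewrite !quot_mulE mulgA.
Qed.

Lemma quot_mul1 : left_id quot_one quot_mul.
Proof. by move=> u; rewrite -(coset_repr u) quot_mulE mul1g. Qed.

Lemma quot_mulr1 : right_id quot_one quot_mul.
Proof. by move=> u; rewrite -(coset_repr u) quot_mulE mulg1. Qed.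

Lemma quot_mulV : left_inverse quot_one quot_inv quot_mul.
Proof. by move=> u; rewrite -{2}(coset_repr u) quot_mulE mulVg. Qed.

Lemma quot_mulrV : right_inverse quot_one quot_inv quot_mul.
Proof. by move=> u; rewrite -{1}(coset_repr u) quot_mulE mulgV. Qed.

HB.instance Definition _ := isGroup.Build quotient_group
  quot_mulA quot_mul1 quot_mulr1 quot_mulV quot_mulrV.

Lemma cosetM : {morph coset : x y / x * y}.
Proof. by move=> x y; rewrite -quot_mulE. Qed.

HB.instance Definition _ := isMultiplicative.Build G quotient_group coset cosetM.

End QuotientGroup.

(* Only the values of f on S matter, so f stands for an injective homomorphism
   from the subgroup S to H. *)
Definition embeds (G H : groupType) (S : set G) : Prop :=
  exists f : G -> H, {in S &, {morph f : x y / x * y}} /\ {in S &, injective f}.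

Section Automorphisms.
Variables (V : zmodType) (A : finType).

Definition config : Type := {ptws V -> discrete_topology A}.
HB.instance Definition _ := Topological.on config.

(* (g x)_h = x_{g^-1 h}, with the group law of V written additively *)
Definition shift (g : V) (x : config) : config := fun h => x (- g + h)%R.

Definition equivariant (f : config -> config) : Prop :=
  forall g x, f (shift g x) = shift g (f x).

Definition homeomorphism (f : config -> config) : Prop :=
  continuous f /\
  exists f' : config -> config, [/\ continuous f', cancel f f' & cancel f' f].

Definition AutShift : Type :=
  {f : config -> config | `[< homeomorphism f /\ equivariant f >]}.
HB.instance Definition _ := Choice.on AutShift.

Definition aut_fun (f : AutShift) : config -> config := sval f.
Coercion aut_fun : AutShift >-> Funclass.

Lemma autP (f : AutShift) : homeomorphism f /\ equivariant f.
Proof. exact/asboolP/(svalP f). Qed.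

Lemma aut_eq (f g : AutShift) : (f : config -> config) =1 g -> f = g.
Proof. by move=> fg; apply/val_inj/funext. Qed.

Definition mkAut f (hf : homeomorphism f) (ef : equivariant f) : AutShift :=
  exist _ f (introT (asboolP _) (conj hf ef)).

Lemma id_homeo : homeomorphism id.
Proof. by split; [|exists id; split] => // x; exact: cvg_id. Qed.

Lemma comp_homeo f g :
  homeomorphism f -> homeomorphism g -> homeomorphism (f \o g).
Proof.
move=> [cf [f' [cf' fK f'K]]] [cg [g' [cg' gK g'K]]]; split.
  by move=> x; apply: continuous_comp; [exact: cg | exact: cf].
exists (g' \o f'); split; [|exact: can_comp|exact: can_comp].
by move=> x; apply: continuous_comp; [exact: cf' | exact: cg'].
Qed.

Lemma comp_equivariant f g :
  equivariant f -> equivariant g -> equivariant (f \o g).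
Proof. by move=> ef eg v x; rewrite /= eg ef. Qed.

Definition aut_one : AutShift := mkAut id_homeo (fun _ _ => erefl).

Definition aut_mul (f g : AutShift) : AutShift :=
  mkAut (comp_homeo (autP f).1 (autP g).1)
        (comp_equivariant (autP f).2 (autP g).2).

Lemma aut_inv_ex (f : AutShift) : exists g : AutShift, cancel f g /\ cancel g f.
Proof.
have [[cf [f' [cf' fK f'K]]] ef] := autP f.
have hf' : homeomorphism f' by split=> //; exists f.
have ef' : equivariant f'.
  by move=> v x; rewrite -{1}(f'K x) -ef fK.
by exists (mkAut hf' ef').
Qed.

Definition aut_inv (f : AutShift) : AutShift := sval (cid (aut_inv_ex f)).

Lemma aut_mulA : associative aut_mul.
Proof. by move=> f g h; exact: aut_eq. Qed.

Lemma aut_mul1 : left_id aut_one aut_mul.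
Proof. by move=> f; exact: aut_eq. Qed.

Lemma aut_mulr1 : right_id aut_one aut_mul.
Proof. by move=> f; exact: aut_eq. Qed.

Lemma aut_mulV : left_inverse aut_one aut_inv aut_mul.
Proof.
by move=> f; apply: aut_eq => x; exact: (svalP (cid (aut_inv_ex f))).1.
Qed.

Lemma aut_mulrV : right_inverse aut_one aut_inv aut_mul.
Proof.
by move=> f; apply: aut_eq => x; exact: (svalP (cid (aut_inv_ex f))).2.
Qed.

HB.instance Definition _ := isGroup.Build AutShift
  aut_mulA aut_mul1 aut_mulr1 aut_mulV aut_mulrV.

End Automorphisms.

(* Main.v *)
(* In dimension d a word of length L in finitely many automorphisms has radius
   O(L), so if it is nontrivial it already acts nontrivially on the configurations
   of period O(L), a set of at most #|A| ^ (O(L) ^ d) points.  The group in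
   dimension D defeats this: it contains, for every n = 2^k, a Heisenberg system
   f_j, g_j (j < n ^ D) whose common commutator kappa is a word of length O(n),
   although f_j and g_j themselves may be long.  Restricting to an eigenspace of
   kappa, an action in which kappa is nontrivial needs 2 ^ (n ^ D) points.  The
   f_j and g_j are written as commutators, so the relations survive in any lift
   modulo a central subgroup.

   The automorphisms are shears: cells of a configuration that carry a fixed
   unbordered frame hold a vector of bits, and a shear adds to one bit a function
   of the others.  kappa adds to one bit the indicator of a certificate, a labelled
   box of side n whose corner is determined by any part of the box, so that two
   certified corners are never closer than n.  A line of n cells is checked in O(n)
   steps because the powers of the second-order step (p, q) |-> (A p + q, p) are
   given by Fibonacci polynomials in A, and over F_2 the 2^k-th one is the single
   monomial A ^ (2^k - 1).  The box is checked one direction at a time, storing the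
   outcome of each level in a carry bit that is required to have been clear, so
   that each direction costs only a constant factor. *)

Require Import Defs.
From mathcomp Require Import all_boot all_order all_fingroup all_algebra all_field.
From mathcomp Require Import spectral generic_quotient zify.
From mathcomp Require Import mathcomp_extra boolp classical_sets functions cardinality.
From mathcomp Require Import filter topology function_spaces.
(* Imported again because fingroup shadows coset and generated. *)
Require Import Defs.

Set Implicit Arguments.
Unset Strict Implicit.
Unset Printing Implicit Defensive.

Import GRing.Theory Num.Theory.

(** * Heisenberg relations among permutations *)

Section HeisenbergBound.
Local Open Scope ring_scope.
Variables (C : numClosedFieldType) (m : nat).

(** In a row basis of [V] the restriction of [A] is a square matrix of positive size over an
    algebraically closed field. *)
Lemma stable_eigen_ex (V A : 'M[C]_m) :
  V != 0 -> stablemx V A -> exists a, (V :&: eigenspace A a)%MS != 0.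
Proof.
move=> V0 sVA; have rV : (0 < \rank V)%N by rewrite lt0n mxrank_eq0.
have [a /eigenvalueP[v va v0]] := eigenvalue_closed (conjmx (row_base V) A) rV.
exists a; apply/rowV0Pn; exists (v *m row_base V).
  rewrite sub_capmx mulmx_sub ?eq_row_base //=; apply/eigenspaceP.
  rewrite scalemxAl -va /conjmx -[RHS]mulmxA mulmxKpV ?stablemx_row_base //.
  by rewrite mulmxA.
by rewrite mulmx_free_eq0 ?row_base_free.
Qed.

Variables (F G : nat -> 'M[C]_m) (w : C).
Hypotheses (w1 : w != 1) (w0 : w != 0).

(** Each pair doubles the rank. On [V], [G N] maps the [a]-eigenspace of [F N] injectively into the
    [a / w]-eigenspace; the two meet trivially because [w != 1] and [a != 0], and the first is
    stable under the remaining pairs, so induction applies to it. *)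
Lemma heisenberg_rank N (V : 'M[C]_m) :
  V != 0 ->
  (forall i, (i < N)%N -> [/\ stablemx V (F i), stablemx V (G i),
                            F i \in unitmx & G i \in unitmx]) ->
  (forall i j, (i < N)%N -> (j < N)%N -> F i *m F j = F j *m F i) ->
  (forall i j, (i < N)%N -> (j < N)%N -> i != j -> F i *m G j = G j *m F i) ->
  (forall i, (i < N)%N -> V *m (F i *m G i) = w *: (V *m (G i *m F i))) ->
  (2 ^ N <= \rank V)%N.
Proof.
elim: N V => [|N IH] V V0 st FF FG FGw; first by rewrite lt0n mxrank_eq0.
have [sF sG uF uG] := st N (ltnSn N).
have [a Ea] := stable_eigen_ex V0 sF.
pose E b := (V :&: eigenspace (F N) b)%MS; rewrite -/(E a) in Ea.
have EV b : (E b <= V)%MS by exact: capmxSl.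
have EF b : E b *m F N = b *: E b by apply/eigenspaceP; exact: capmxSr.
have a0 : a != 0.
  apply: contraNneq Ea => a0; have /eqP := EF a; rewrite a0 scale0r.
  by rewrite mulmx_free_eq0 // row_free_unit.
have IHE : (2 ^ N <= \rank (E a))%N.
  apply: IH => // [i iN|i j iN jN|i j iN jN|i iN].
  - have iN1 : (i < N.+1)%N by rewrite ltnS ltnW.
    have [sFi sGi uFi uGi] := st i iN1.
    split=> //; rewrite sub_capmx; apply/andP; split.
    + exact: submx_trans (submxMr _ (EV a)) sFi.
    + apply/eigenspaceP.
      by rewrite -mulmxA FF // mulmxA EF scalemxAl.
    + exact: submx_trans (submxMr _ (EV a)) sGi.
    + apply/eigenspaceP; rewrite -mulmxA -FG ?mulmxA ?EF ?scalemxAl //.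
      by rewrite neq_ltn iN orbT.
  - by rewrite FF // ltnS ltnW.
  - by move=> ij; rewrite FG // ltnS ltnW.
  - have /submxP[X ->] := EV a.
    by rewrite -!mulmxA FGw 1?ltnS 1?ltnW // -scalemxAr.
have EG : (E a *m G N <= E (a / w))%MS.
  rewrite sub_capmx (submx_trans (submxMr _ (EV a)) sG) /=.
  apply/eigenspaceP; have /submxP[X EX] := EV a.
  have : a *: (E a *m G N) = w *: (E a *m G N *m F N).
    rewrite scalemxAl -EF EX -!mulmxA FGw ?ltnSn //.
    by rewrite -scalemxAr.
  move=> aw; have -> : a / w = w^-1 * a by rewrite mulrC.
  by rewrite -scalerA aw scalerA mulVf // scale1r.
have rEG : (\rank (E a) <= \rank (E (a / w)))%N.
  by apply: leq_trans (mxrankS EG); rewrite mxrankMfree // row_free_unit.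
have dis : (E a :&: E (a / w))%MS = 0.
  apply/eqP; rewrite -submx0; apply/rV_subP => v.
  rewrite sub_capmx => /andP[va vb].
  have /eigenspaceP e1 := submx_trans va (capmxSr V (eigenspace (F N) a)).
  have /eigenspaceP e2 := submx_trans vb (capmxSr V (eigenspace (F N) (a / w))).
  have: (a - a / w) *: v == 0 by rewrite scalerBl -e1 -e2 subrr.
  rewrite scaler_eq0 => /orP[|/eqP->]; last exact: sub0mx.
  rewrite -{1}[a]mulr1 -mulrBr mulf_eq0 (negPf a0) subr_eq0 /= => /eqP wV.
  by move: w1; rewrite -[w]invrK -wV invr1 eqxx.
have sub : (E a + E (a / w) <= V)%MS by rewrite addsmx_sub !EV.
have := mxrankS sub; rewrite mxrank_disjoint_sum // => rk.
by rewrite expnS mul2n -addnn (leq_trans _ rk) // leq_add // (leq_trans IHE).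
Qed.

End HeisenbergBound.


(** * Permutation representations over the algebraic numbers *)

Section PermRep.
Local Open Scope ring_scope.
Variable T : finType.

Definition prep (s : {perm T}) : 'M[algC]_#|T| :=
  \matrix_(i, j) (enum_val j == s (enum_val i))%:R.

Lemma prepM s t : prep (s * t)%g = prep s *m prep t.
Proof.
apply/matrixP => i j; rewrite !mxE (bigD1 (enum_rank (s (enum_val i)))) //=.
rewrite !mxE enum_rankK eqxx mul1r permM big1 ?addr0 // => k ne.
rewrite !mxE; case: eqP => [e|_]; last by rewrite mulr0n mul0r.
by rewrite -e enum_valK eqxx in ne.
Qed.

Lemma prep1 : prep 1%g = 1%:M.
Proof.
apply/matrixP => i j; rewrite !mxE perm1 (inj_eq enum_val_inj).
by rewrite eq_sym.
Qed.

Lemma prep_inj : injective prep.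
Proof.
move=> s t /matrixP st; apply/permP => x.
have := st (enum_rank x) (enum_rank (s x)); rewrite !mxE !enum_rankK eqxx.
by case: eqP => // _ /eqP; rewrite oner_eq0.
Qed.

Lemma prep_unit s : prep s \in unitmx.
Proof.
have : prep s *m prep s^-1%g = 1%:M by rewrite -prepM mulgV prep1.
by case/mulmx1_unit.
Qed.

(** An eigenvector [v] is taken in the image of [prep k - 1%:M]. If its eigenvalue were 1, then
    [v = u (k - 1)] would give [u k^n = u + n v] for all [n], which at the order of [k] forces
    [v = 0] in characteristic 0. *)
Lemma perm_eigenvalue (k : {perm T}) : k != 1%g ->
  exists2 w : algC, w != 1 & eigenspace (prep k) w != 0.
Proof.
move=> k1; pose V := <<prep k - 1%:M>>%MS.
have V0 : V != 0.
  rewrite -mxrank_eq0 mxrank_gen mxrank_eq0 subr_eq0 -prep1.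
  by rewrite (inj_eq prep_inj).
have sV : stablemx V (prep k).
  rewrite /V (eqmxMr _ (genmxE _)) genmxE.
  by rewrite mulmxBl mul1mx -{3}[prep k]mulmx1 -mulmxBr submxMl.
have [w /rowV0Pn[v]] := stable_eigen_ex V0 sV.
rewrite sub_capmx => /andP[vV vw] v0; exists w; last first.
  by apply: contraNneq v0 => w0; move: vw; rewrite w0 submx0.
apply: contraNneq v0 => w1; move: vV; rewrite /V genmxE => /submxP[u uv].
have vk : v *m prep k = v by move/eigenspaceP: vw; rewrite w1 scale1r.
have un n : u *m prep (k ^+ n)%g = u + n%:R *: v.
  elim: n => [|n IH]; first by rewrite expg0 prep1 mulmx1 scale0r addr0.
  rewrite expgSr prepM mulmxA IH mulmxDl -scalemxAl vk.
  have -> : u *m prep k = u + v by rewrite uv mulmxBr mulmx1 addrC subrK.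
  by rewrite mulrSr scalerDl scale1r -addrA [v + _]addrC.
have /eqP := un #[k]%g; rewrite expg_order prep1 mulmx1.
rewrite -{1}[u]addr0 (inj_eq (addrI _)) eq_sym scaler_eq0 pnatr_eq0.
by rewrite -leqn0 leqNgt order_gt0 => /eqP ->.
Qed.

(** On an eigenspace of [k] with eigenvalue [w != 1], stable under everything commuting with [k],
    the group relation becomes the scalar one. *)
Lemma heisenberg_perm N (F G : nat -> {perm T}) (k : {perm T}) :
  k != 1%g ->
  (forall i, (i < N)%N -> commute k (F i) /\ commute k (G i)) ->
  (forall i j, (i < N)%N -> (j < N)%N -> commute (F i) (F j)) ->
  (forall i j, (i < N)%N -> (j < N)%N -> i != j -> commute (F i) (G j)) ->
  (forall i, (i < N)%N -> F i * G i = k * (G i * F i))%g ->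
  (2 ^ N <= #|T|)%N.
Proof.
move=> k1 ck FF FG FGk; have [w w1 V0] := perm_eigenvalue k1.
have w0 : w != 0.
  apply: contraNneq V0 => w0.
  have /eqP : eigenspace (prep k) w *m prep k = 0.
    by rewrite (eigenspaceP (submx_refl _)) w0 scale0r.
  by rewrite mulmx_free_eq0 // row_free_unit prep_unit.
apply: leq_trans (rank_leq_row (eigenspace (prep k) w)).
apply: (@heisenberg_rank _ _ (prep \o F) (prep \o G) w) => //= [i iN|i j iN jN|i j iN jN ij|i iN].
- have [c1 c2] := ck i iN.
  by split; rewrite ?prep_unit //; apply: comm_mx_stable_eigenspace;
    rewrite /comm_mx -!prepM (c1, c2).
- by rewrite -!prepM FF.
- by rewrite -!prepM FG.
- rewrite -!prepM FGk // prepM mulmxA.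
  by rewrite (eigenspaceP (submx_refl _)) scalemxAl.
Qed.

End PermRep.

(** * Lifting the relations through a central quotient *)

Section CentralCommutators.
Local Open Scope group_scope.
Variable H : groupType.
Implicit Types x y z a b c : H.

Lemma center1 : center H 1.
Proof. by move=> y; apply/commute_sym/commute1. Qed.

Lemma center_conjg c x : center H c -> c ^ x = c.
Proof. by move=> cc; rewrite conjgE cc mulKg. Qed.

Lemma commgMcl a c x : center H c -> [~ a * c, x] = [~ a, x].
Proof.
move=> cc; rewrite -(cc a) !commgEl conjMg (center_conjg _ cc) invgM.
by rewrite -mulgA mulKg.
Qed.

Lemma commgMcr a c x : center H c -> [~ x, a * c] = [~ x, a].
Proof. by move=> cc; rewrite -invgR commgMcl // invgR. Qed.

Lemma conjg_modc a x : a ^ x = a * [~ a, x].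
Proof. by rewrite commgEl mulVKg. Qed.

(** Conjugation by [x] multiplies [a] and [b] by central elements, which a commutator does not see.
    Commutation modulo the center thus becomes exact for commutators. *)
Lemma commute_commg x a b :
  center H [~ a, x] -> center H [~ b, x] -> commute x [~ a, b].
Proof.
move=> ca cb; apply/commute_sym/commgP/conjg_fixP.
by rewrite conjRg !conjg_modc commgMcl // commgMcr.
Qed.

Variables (N : nat) (a e : H) (b c : nat -> H).
Let f j := [~ a, b j].
Let g j := [~ c j, e].
Let v j := [~ b j, g j].
Hypothesis N_gt1 : 1 < N.
Hypothesis fa : forall i, i < N -> center H [~ a, f i].
Hypothesis fb : forall i j, i < N -> j < N -> center H [~ b j, f i].
Hypothesis gc : forall i j, i < N -> j < N -> center H [~ c j, g i].
Hypothesis ge : forall i, i < N -> center H [~ e, g i].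
Hypothesis fc : forall i j, i < N -> j < N -> i != j -> center H [~ c j, f i].
Hypothesis fe : forall i, i < N -> center H [~ e, f i].
Hypothesis ga : forall i, i < N -> center H [~ a, g i].
Hypothesis vv : forall i, i < N -> center H ((v 0)^-1 * v i).

Lemma lift_ff i j : i < N -> j < N -> commute (f i) (f j).
Proof. by move=> iN jN; apply: commute_commg; [exact: fa | exact: fb]. Qed.

Lemma lift_gg i j : i < N -> j < N -> commute (g i) (g j).
Proof. by move=> iN jN; apply: commute_commg; [exact: gc | exact: ge]. Qed.

Lemma lift_fg i j : i < N -> j < N -> i != j -> commute (f i) (g j).
Proof. by move=> iN jN ij; apply: commute_commg; [exact: fc | exact: fe]. Qed.

Let other i : exists2 j, j < N & i != j.
Proof. by case: i => [|i]; [exists 1%N | exists 0%N; rewrite // ltnW]. Qed.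

(* For l != i, f i commutes with b l and g l modulo the center, hence with v l;
   and v l = v j modulo the center. *)
Lemma lift_fv i j : i < N -> j < N -> commute (f i) (v j).
Proof.
move=> iN jN; have [l lN il] := other i.
have fl : commute (f i) (v l).
  apply: commute_commg; first exact: fb.
  have /eqP -> : [~ g l, f i] == 1.
    by apply/commgP/commute_sym/lift_fg.
  exact: center1.
have vE k : k < N -> v k = v 0 * ((v 0)^-1 * v k) by rewrite mulVKg.
have f0 : commute (f i) (v 0).
  have := commuteM fl (commuteV (commute_sym (vv lN (f i)))).
  by rewrite invgM invgK mulgA mulgV mul1g.
by rewrite vE //; apply: commuteM => //; apply/commute_sym/vv.
Qed.

(** Conjugation by [g j] changes [a] by a central factor and turns [b j] into [b j * v j]. The
    commutator [[~ a, b j * v j]] splits off [[~ a, v j]] because [f j] commutes with [v j]. *)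
Lemma lift_kappa j : j < N -> f j ^ g j = [~ a, v 0] * f j.
Proof.
move=> jN; rewrite /f conjRg.
rewrite (conjg_modc a) (commgMcl _ _ (ga jN)) (conjg_modc (b j)) -/(v j).
have -> : [~ a, b j * v j] = [~ a, v j] * [~ a, b j] ^ v j.
  by rewrite !(commgEl a) conjgM (conjMg a^-1) conjVg -mulgA mulVKg.
have /conjg_fixP -> : [~ f j, v j] == 1 by apply/commgP/lift_fv.
congr (_ * _).
by rewrite -[v j](mulVKg (v 0)) commgMcr //; exact: vv.
Qed.

(** The element [[~ a, v 0]] is also a word in [f l] and [g l] for any [l != j], and these commute
    with [f j] and [g j]. *)
Lemma lift_kappaC j : j < N ->
  commute [~ a, v 0] (f j) /\ commute [~ a, v 0] (g j).
Proof.
move=> jN; have [l lN jl] := other j.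
have kE : [~ a, v 0] = (g l)^-1 * (f l * g l) * (f l)^-1.
    by rewrite -conjgE lift_kappa ?mulgK.
have cm x : commute x (f l) -> commute x (g l) -> commute [~ a, v 0] x.
    move=> xf xg; apply: commute_sym; rewrite kE.
    apply: commuteM; last exact: commuteV.
    by apply: commuteM; [exact: commuteV | exact: commuteM].
by split; apply: cm; [exact: lift_ff | exact: lift_fg
  | apply/commute_sym/lift_fg; rewrite // eq_sym | exact: lift_gg].
Qed.

Lemma lift_fgk j : j < N -> f j * g j = [~ a, v 0] * (g j * f j).
Proof.
move=> jN; have [_ kg] := lift_kappaC jN.
by rewrite (conjgC (f j)) lift_kappa // mulgA -kg -mulgA.
Qed.

End CentralCommutators.

(** * Locality and periodic points *)

Section Cylinders.
Local Open Scope classical_set_scope.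
Variables (V : zmodType) (A : finType).
Implicit Types (x y : config V A) (D : seq V).

Definition agree D x y := {in D, x =1 y}.

(** Its convergence to [x] is [nbhs_cyl]; together with [cyl_nbhs] this makes cylinders a base of
    neighborhoods. *)
Definition cyl_filter x : set_system (config V A) :=
  [set U | exists D, forall y, agree D x y -> U y].

Lemma cyl_filter_filter x : Filter (cyl_filter x).
Proof.
split=> [|P Q [D DP] [E EQ]|P Q PQ [D DP]]; first by exists [::].
- exists (D ++ E) => y xy; split; [apply: DP|apply: EQ] => v vD; apply: xy;
  by rewrite mem_cat vD ?orbT.
- by exists D => y /DP /PQ.
Qed.

Lemma nbhs_cyl x (U : set (config V A)) :
  nbhs x U -> exists D, forall y, agree D x y -> U y.
Proof.
suff : cyl_filter x --> x by apply.
have := cyl_filter_filter x => FF.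
apply/cvg_sup => v W /= [_ [[B Bop <-] Bx BW]].
exists [:: v] => y xy; apply: BW; rewrite /preimage /=.
by rewrite /proj -xy ?mem_head.
Qed.

Lemma cyl_nbhs x D : nbhs x [set y | agree D x y].
Proof.
elim: D => [|v D IH]; first by apply: filterS filterT => y _ w.
have nv : nbhs x [set y | x v = y v].
  have : nbhs x (proj v @^-1` [set (proj v x : discrete_topology A)]).
    exact: (@proj_continuous V (fun _ => discrete_topology A) v x _ (discrete_set1 _)).
  by apply: filterS => y /esym.
apply: filterS (filterI nv IH) => y [/= e yD] w.
by rewrite inE => /predU1P[->|/yD].
Qed.

Lemma local_continuous (f : config V A -> config V A) :
  (forall v, exists D, forall x y, agree D x y -> f x v = f y v) ->
  continuous f.
Proof.
move=> loc x U /nbhs_cyl[D DU].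
have [E fE] : exists E, forall y, agree E x y -> agree D (f x) (f y).
  elim: D {DU} => [|v D [E fE]]; first by exists [::].
  have [E' vE'] := loc v; exists (E' ++ E) => y xy w.
  rewrite inE => /predU1P[->|wD]; first by apply: vE' => u uE; apply: xy; rewrite mem_cat uE.
  by apply: fE wD => u uE; apply: xy; rewrite mem_cat uE orbT.
by apply: filterS (cyl_nbhs x E) => y /fE /DU.
Qed.

Lemma config_compact : compact [set: config V A].
Proof.
have := @tychonoff V (fun _ => discrete_topology A) (fun _ => setT).
rewrite (_ : [set f | _] = setT) => [|]; last by rewrite eqEsubset.
by apply=> v; apply: finite_compact; exact: finite_finset.
Qed.

(** The compactness half of the Curtis-Hedlund-Lyndon theorem. If locality fails, the configurations
    with a partner that agrees on a large window but has another image at [v] generate a proper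
    filter. At a cluster point of it, continuity makes the value at [v] locally constant, a
    contradiction. *)
Lemma continuous_local (f : config V A -> config V A) v :
  continuous f -> exists D, forall x y, agree D x y -> f x v = f y v.
Proof.
move=> cf; apply: contrapT => nloc.
pose F : set_system (config V A) := [set U | exists D, forall D' x y,
  {subset D <= D'} -> agree D' x y -> f x v <> f y v -> U x].
have FF : ProperFilter F.
  split.
    move=> [D DF]; apply: nloc; exists D => x y xy; apply: contrapT => ne.
    exact: (DF D x y).
  split=> [|P Q [D DP] [E EQ]|P Q PQ [D DP]]; first by exists [::].
  - exists (D ++ E) => D' x y sD xy ne; split;
    [apply: (DP D' x y)|apply: (EQ D' x y)] => // u uD; apply: sD;
    by rewrite mem_cat uD ?orbT.
  - by exists D => D' x y sD xy ne; apply: PQ; exact: (DP D' x y).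
have [x [_ clx]] := config_compact FF filterT.
have [D fD] : exists D, forall y, agree D x y -> f x v = f y v.
  have /nbhs_cyl[D DU] := cf x _ (cyl_nbhs (f x) [:: v]).
  by exists D => y /DU /= /(_ v (mem_head _ _)).
have FD : F [set y | exists D' z, [/\ {subset D <= D'}, agree D' y z & f y v <> f z v]].
  by exists D => D' y z sD yz ne; exists D', z.
have [y [[D' [z [sD yz ne]]] xy]] := clx _ _ FD (cyl_nbhs x D).
apply: ne; rewrite -(fD y) // -(fD z) // => u uD.
by rewrite (xy u uD); apply: yz; exact: sD.
Qed.

End Cylinders.

(** * Radii of automorphisms *)

Section Radius.
Local Open Scope ring_scope.
Variables (d : nat) (A : finType).
Notation V := 'rV[int]_d.
Notation cfg := (config V A).
Implicit Types (f g : cfg -> cfg) (x y : cfg) (h : AutShift V A) (u v : V).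

Definition inbox R (v : V) : bool := [forall i, (`|v ord0 i| <= R)%N].

Lemma inboxP R v : reflect (forall i, (`|v ord0 i| <= R)%N) (inbox R v).
Proof. exact: forallP. Qed.

Lemma inbox_add R S u v : inbox R u -> inbox S v -> inbox (R + S) (u + v).
Proof.
move=> /inboxP uR /inboxP vS; apply/inboxP => i; rewrite mxE.
move: (uR i) (vS i); move: (u ord0 i) (v ord0 i) => a b. lia.
Qed.

Definition radius R f : Prop :=
  forall x y, (forall v, inbox R v -> x v = y v) -> f x 0 = f y 0.

Lemma equivariantE f x v : equivariant f -> f x v = f (shift (- v) x) 0.
Proof. by move=> ef; rewrite ef /shift opprK addr0. Qed.

Lemma radius_at R f x y v : equivariant f -> radius R f ->
  (forall u, inbox R u -> x (v + u) = y (v + u)) -> f x v = f y v.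
Proof.
move=> ef rf xy; rewrite !(equivariantE _ v ef); apply: rf => u uR.
by rewrite /shift opprK xy.
Qed.

Lemma radius_comp R S f g : equivariant g -> radius R f -> radius S g ->
  radius (R + S) (f \o g).
Proof.
move=> eg rf rg x y xy; apply: rf => v vR; apply: (radius_at eg rg) => u uS.
exact/xy/inbox_add.
Qed.

Lemma radius_mono R S f : (R <= S)%N -> radius R f -> radius S f.
Proof.
move=> RS rf x y xy; apply: rf => v /inboxP vR; apply: xy.
by apply/inboxP => i; exact: leq_trans (vR i) RS.
Qed.

Lemma radius_ex f : continuous f -> exists R, radius R f.
Proof.
move=> /(continuous_local 0)[D fD].
exists (\sum_(v <- D) \sum_i `|v ord0 i|)%N => x y xy; apply: fD => v vD.
apply/xy/inboxP => i.
rewrite (big_rem v vD) /= (bigD1 i) //= -addnA; exact: leq_addr.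
Qed.

(** The inverse is bounded too, so that radii of commutators can be estimated. *)
Definition aut_radius R h : Prop := radius R h /\ radius R (aut_fun h^-1%g).

Lemma aut_radius_ex h : exists R, aut_radius R h.
Proof.
have [R rR] := radius_ex (autP h).1.1.
have [S rS] := radius_ex (autP h^-1%g).1.1.
exists (R + S)%N; split; first exact: radius_mono (leq_addr _ _) rR.
exact: radius_mono (leq_addl _ _) rS.
Qed.

Lemma aut_radius_mono R S h : (R <= S)%N -> aut_radius R h -> aut_radius S h.
Proof. by move=> RS [r1 r2]; split; apply: radius_mono RS _. Qed.

Lemma aut_radius1 R : aut_radius R 1%g.
Proof.
have r1 : radius R (1%g : AutShift V A).
  by move=> x y xy; apply: (xy 0); apply/inboxP => i; rewrite mxE.
by split; rewrite ?invg1.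
Qed.

Lemma aut_radiusM R S h k :
  aut_radius R h -> aut_radius S k -> aut_radius (R + S) (h * k)%g.
Proof.
move=> [h1 h2] [k1 k2]; split.
  exact: radius_comp (autP k).2 h1 k1.
by rewrite invgM addnC; exact: radius_comp (autP h^-1%g).2 k2 h2.
Qed.

Lemma aut_radiusV R h : aut_radius R h -> aut_radius R h^-1%g.
Proof. by move=> [h1 h2]; split; rewrite ?invgK. Qed.

Lemma aut_radiusR R S h k : aut_radius R h -> aut_radius S k ->
  aut_radius (R + S).*2 [~ h, k]%g.
Proof.
move=> rh rk.
have -> : [~ h, k]%g = ((h^-1 * k^-1) * (h * k))%g.
  by rewrite commgEl conjgE !mulgA.
by rewrite -addnn; apply: aut_radiusM; apply: aut_radiusM => //; exact: aut_radiusV.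
Qed.

End Radius.

(** * The action on periodic configurations *)

Section Periodic.
Local Open Scope ring_scope.
Variables (d : nat) (A : finType) (R : nat).
Notation V := 'rV[int]_d.
Notation cfg := (config V A).
Let m := R.*2.+1.
Definition torus := {ffun 'I_d -> 'I_R.*2.+1}.
Definition pattern := {ffun torus -> A}.

Definition torus_of (v : V) : torus :=
  [ffun i => inord `|(v ord0 i %% m)%Z|].
Definition torus_rep (q : torus) : V := \row_i (Posz (q i)).
(** Representatives between [-R] and [R], centered so that the box of radius [R] is one fundamental
    domain. *)
Definition torus_mid (q : torus) : V :=
  \row_i (if (q i <= R)%N then Posz (q i) else Posz (q i) - Posz m).
Definition tile (p : pattern) : cfg := fun v => p (torus_of v).
Definition crop (x : cfg) : pattern := [ffun q => x (torus_rep q)].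

Lemma torus_repK : cancel torus_rep torus_of.
Proof.
move=> q; apply/ffunP => i; apply/val_inj; rewrite ffunE mxE /=.
by rewrite modz_nat absz_nat modn_small ?inordK.
Qed.

Lemma tileK : cancel tile crop.
Proof. by move=> p; apply/ffunP => q; rewrite ffunE /tile torus_repK. Qed.

Lemma torus_of_shift (v w : V) : torus_of (w *+ m + v) = torus_of v.
Proof.
apply/ffunP => i; rewrite !ffunE !mxE; congr (inord (absz _)).
by rewrite mulmxnE -mulr_natr natz modzMDl.
Qed.

Lemma torus_decomp v : exists w, v = w *+ m + torus_rep (torus_of v).
Proof.
exists (\row_i (v ord0 i %/ m)%Z); apply/rowP => i.
rewrite mxE mulmxnE !mxE ffunE -mulr_natr natz inordK ?absz_mod_lt.
  rewrite {1}(divz_eq (v ord0 i) m); congr (_ + _).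
  by rewrite gez0_abs // modz_ge0.
by rewrite /m; have := ltz_pmod (v ord0 i) (isT : 0 < Posz m); 
  have := modz_ge0 (v ord0 i) (isT : Posz m != 0); lia.
Qed.

Lemma tile_periodic (f : cfg -> cfg) p : equivariant f ->
  tile (crop (f (tile p))) = f (tile p).
Proof.
move=> ef; apply/funext => v; rewrite /tile ffunE.
have [w vw] := torus_decomp v.
have per : shift (- (w *+ m)) (tile p) = tile p.
  by apply/funext => u; rewrite /shift opprK /tile torus_of_shift.
have := congr1 (fun x => x (torus_rep (torus_of v))) (ef (- (w *+ m)) (tile p)).
by rewrite per /shift opprK -vw.
Qed.

Definition patt_act (h : AutShift V A) (p : pattern) := crop (h (tile p)).

Lemma patt_actM h k p : patt_act (h * k)%g p = patt_act h (patt_act k p).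
Proof. by rewrite /patt_act tile_periodic //; exact: (autP k).2. Qed.

Lemma patt_act1 p : patt_act 1%g p = p.
Proof. exact: tileK. Qed.

Lemma patt_act_inj h : injective (patt_act h).
Proof.
by apply: (can_inj (g := patt_act h^-1%g)) => p; rewrite -patt_actM mulVg patt_act1.
Qed.

(** Permutations multiply from left to right and automorphisms compose from right to left; the
    inverse makes this a homomorphism. *)
Definition patt_perm h : {perm pattern} := perm (@patt_act_inj h^-1%g).

Lemma patt_permM h k : patt_perm (h * k)%g = (patt_perm h * patt_perm k)%g.
Proof. by apply/permP => p; rewrite permM !permE invgM patt_actM. Qed.

Lemma torus_midK v : inbox R v -> torus_mid (torus_of v) = v.
Proof.
move=> /inboxP vR; apply/rowP => i; rewrite !mxE ffunE.
have {vR} := vR i; move: (v ord0 i) => a aR.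
have [a0|a0] := lerP 0 a.
  have am : (a %% m)%Z = a by rewrite modz_small // a0 /=; rewrite /m; lia.
  rewrite am inordK; last by lia.
  by rewrite aR gez0_abs.
have am : (a %% m)%Z = a + m.
  by rewrite -(modzDr a m) modz_small //; rewrite /m; lia.
have e : absz (a + m) = (m - absz a)%N by rewrite /m; lia.
rewrite am e inordK; last by rewrite /m; lia.
have -> : (m - absz a <= R)%N = false by apply/negbTE; rewrite /m; lia.
by rewrite /m; lia.
Qed.

(** The value of [h^-1] on [x] at a site is computed on a periodic configuration copying [x] within
    distance [R] of that site. If all periodic configurations are fixed, so is [x]. *)
Lemma patt_perm_neq1 h : aut_radius R h -> h != 1%g -> patt_perm h != 1%g.
Proof.
move=> [_ rh] h1; apply: contra_neq h1 => /permP ph.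
apply: invg_inj; rewrite invg1; apply: aut_eq => x; apply/funext => v.
rewrite (equivariantE _ _ (autP h^-1%g).2).
set y := shift (- v) x; pose p : pattern := [ffun q => y (torus_mid q)].
have py u : inbox R u -> y u = tile p u.
  by move=> uR; rewrite /tile ffunE torus_midK.
rewrite (rh _ _ py).
have := ph p; rewrite perm1 permE => /(congr1 (fun q => tile q 0)).
rewrite /patt_act tile_periodic; last exact: (autP h^-1%g).2.
move=> ->; rewrite -py; last by apply/inboxP => i; rewrite mxE.
by rewrite /y /shift opprK addr0.
Qed.

(** Only [k] is bounded in radius: it alone must act nontrivially on the patterns, while [F] and [G]
    merely have to act. *)
Lemma heisenberg_aut N (F G : nat -> AutShift V A) (k : AutShift V A) :
  aut_radius R k -> k != 1%g ->
  (forall i, (i < N)%N -> commute k (F i) /\ commute k (G i)) ->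
  (forall i j, (i < N)%N -> (j < N)%N -> commute (F i) (F j)) ->
  (forall i j, (i < N)%N -> (j < N)%N -> i != j -> commute (F i) (G j)) ->
  (forall i, (i < N)%N -> F i * G i = k * (G i * F i))%g ->
  (2 ^ N <= #|A| ^ (R.*2.+1 ^ d))%N.
Proof.
move=> rk k1 ck FF FG FGk.
have -> : (#|A| ^ (R.*2.+1 ^ d) = #|{: pattern}|)%N.
  by rewrite !card_ffun !card_ord.
have hom x y : commute x y -> commute (patt_perm x) (patt_perm y).
  by move=> xy; rewrite /commute -!patt_permM xy.
apply: (@heisenberg_perm _ N (patt_perm \o F) (patt_perm \o G) (patt_perm k)).
- exact: patt_perm_neq1.
- by move=> i /ck[c1 c2]; split; apply: hom.
- by move=> i j iN jN; apply/hom/FF.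
- by move=> i j iN jN ij; apply/hom/FG.
- by move=> i iN /=; rewrite -!patt_permM FGk.
Qed.

End Periodic.

(** * Word length in a generated subgroup *)

Section Words.
Local Open Scope classical_set_scope.
Local Open Scope group_scope.
Variables (G : groupType) (S : set G).

Definition word_ball L (g : G) : Prop := exists s : seq G,
  [/\ size s <= L, forall x, x \in s -> S x & g = \prod_(x <- s) x].

Lemma generatedM x y : generated S x -> generated S y -> generated S (x * y).
Proof.
move=> gx gy; apply/set_mem.
by apply: (group_closedM (subgroup_generated S)); exact/mem_set.
Qed.

Lemma generatedV x : generated S x -> generated S x^-1.
Proof.
move=> gx; apply/set_mem.
by apply: (group_closedV (subgroup_generated S)); exact/mem_set.
Qed.

Lemma generated1 : generated S 1.
Proof. exact/set_mem/(subgroup_generated S).1. Qed.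

Lemma generatedR x y : generated S x -> generated S y -> generated S [~ x, y].
Proof.
move=> gx gy; rewrite commgEl conjgE.
by do ?[apply: generatedM | apply: generatedV | assumption].
Qed.

Lemma generated_gen x : S x -> generated S x.
Proof. by move=> Sx H [_ SH]; exact: SH. Qed.

Lemma word_ball_generated L g : word_ball L g -> generated S g.
Proof.
case=> s [_ sS ->]; elim: s sS => [|x s IH] sS.
  by rewrite big_nil; exact: generated1.
rewrite big_cons; apply: generatedM; first by apply: generated_gen; apply: sS; rewrite inE eqxx.
by apply: IH => y ys; apply: sS; rewrite inE ys orbT.
Qed.

Lemma word_ball_gen x : S x -> word_ball 1 x.
Proof.
move=> Sx; exists [:: x]; split=> // [y|]; first by rewrite inE => /eqP ->.
by rewrite big_seq1.
Qed.

Lemma word_ball1 L : word_ball L 1.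
Proof. by exists [::]; rewrite big_nil. Qed.

Lemma word_ballM L M g h :
  word_ball L g -> word_ball M h -> word_ball (L + M) (g * h).
Proof.
move=> [s [sL sS ->]] [t [tM tS ->]]; exists (s ++ t).
rewrite big_cat size_cat leq_add //; split=> // x.
by rewrite mem_cat => /orP[/sS|/tS].
Qed.

Lemma word_ball_mono L M g : L <= M -> word_ball L g -> word_ball M g.
Proof. by move=> LM [s [sL sS ->]]; exists s; split=> //; exact: leq_trans LM. Qed.

Lemma word_ballX L g n : word_ball L g -> word_ball (L * n) (g ^+ n).
Proof.
move=> gL; elim: n => [|n IH]; first by rewrite muln0 expg0; exact: word_ball1.
by rewrite mulnS expgS; exact: word_ballM.
Qed.

End Words.

(** * From an embedding to an inequality on periodic points *)

Section Obstruction.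
Local Open Scope classical_set_scope.
Local Open Scope group_scope.
Variables (G : groupType) (S : set G) (K : centralSubgroup G).
Variables (d : nat) (A : finType).
Notation H := (AutShift 'rV[int]_d A).
Variables (K' : centralSubgroup H) (phi : quotient_group K -> quotient_group K').
Notation GG := (generated S).
Lemma coset_neq1 x : ~ center G x -> coset K x <> coset K 1.
Proof.
move=> cx /esym/coset_eqP; rewrite invg1 mul1g => /set_mem Kx.
exact/cx/(central_center Kx).
Qed.

Hypothesis finS : finite_set S.
Let I := image GG (coset K).
Hypothesis phiM : {in I &, {morph phi : x y / x * y}}.
Hypothesis phi_inj : {in I &, injective phi}.

Let psi x := phi (coset K x).

Let inI x : GG x -> coset K x \in I.
Proof. by move=> Gx; apply/mem_set; exists x. Qed.

Let psiM x y : GG x -> GG y -> psi (x * y) = psi x * psi y.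
Proof. by move=> Gx Gy; rewrite /psi cosetM phiM ?inI. Qed.

Let psi1 : psi 1 = 1.
Proof.
have := psiM (@generated1 _ S) (@generated1 _ S); rewrite mulg1 => e.
by apply: (@mulgI _ (psi 1)); rewrite -e mulg1.
Qed.

(** A relation rather than a function: two lifts of [x] differ by a central element, see
    [lifts_eq]. *)
Definition lifts (x : G) (x' : H) : Prop := GG x /\ coset K' x' = psi x.

Lemma lifts1 : lifts 1 1.
Proof. by split; [exact: generated1 | rewrite psi1]. Qed.

Lemma liftsM x y x' y' : lifts x x' -> lifts y y' -> lifts (x * y) (x' * y').
Proof.
move=> [Gx ex] [Gy ey]; split; first exact: generatedM.
by rewrite psiM // cosetM ex ey.
Qed.

Lemma liftsV x x' : lifts x x' -> lifts x^-1 x'^-1.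
Proof.
move=> [Gx ex]; have Gx' := generatedV Gx; split=> //.
apply: (@mulgI _ (psi x)); rewrite -psiM // mulgV psi1 -ex -cosetM mulgV //.
Qed.

Lemma liftsR x y x' y' : lifts x x' -> lifts y y' -> lifts [~ x, y] [~ x', y'].
Proof.
move=> lx ly; rewrite !commgEl !conjgE.
by do ?[apply: liftsM | apply: liftsV | assumption].
Qed.

Lemma lifts_eq x x' x'' : lifts x x' -> lifts x x'' -> center H (x'^-1 * x'').
Proof.
move=> [_ e1] [_ e2]; have /coset_eqP /set_mem : coset K' x' = coset K' x''.
  by rewrite e1 e2.
exact: central_center.
Qed.

Lemma lifts_commute x y x' y' : lifts x x' -> lifts y y' -> commute x y ->
  center H [~ x', y'].
Proof.
move=> lx ly xy; have := liftsR lx ly.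
have /eqP -> : [~ x, y] == 1 by exact/commgP.
by move=> /(lifts_eq lifts1); rewrite invg1 mul1g.
Qed.

(** The bound [r] covers one chosen lift of each of the finitely many generators; words are lifted
    letter by letter. *)
Lemma lifts_radius : exists r, forall L g, word_ball S L g ->
  exists2 g', lifts g g' & aut_radius (r * L) g'.
Proof.
have [r rP] : exists r, forall t, S t -> aut_radius r (repr (psi t) : H).
  have /finite_seqP[s sE] := finS.
  have [r rP] : exists r, forall t, t \in s -> aut_radius r (repr (psi t) : H).
    elim: s {sE} => [|t s [r IH]]; first by exists 0%N.
    have [r' rt] := aut_radius_ex (repr (psi t) : H).
    exists (r + r')%N => u; rewrite inE => /predU1P[->|us].
      exact: aut_radius_mono (leq_addl _ _) rt.
    exact: aut_radius_mono (leq_addr _ _) (IH u us).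
  by exists r => t; rewrite sE; exact: rP.
exists r => L g [s [sL sS ->]].
suff [g' lg rg] : exists2 g', lifts (\prod_(x <- s) x) g' & aut_radius (r * size s) g'.
  by exists g' => //; apply: aut_radius_mono rg; rewrite leq_mul2l sL orbT.
elim: s sS {sL} => [|x s IH] sS.
  by exists 1; rewrite ?big_nil; [exact: lifts1 | exact: aut_radius1].
have Sx : S x by apply: sS; rewrite inE eqxx.
have [|g' lg rg] := IH; first by move=> y ys; apply: sS; rewrite inE ys orbT.
exists (repr (psi x) * g').
  rewrite big_cons; apply: liftsM => //; split; first exact: generated_gen.
  exact: coset_repr.
by rewrite /= mulnS; apply: aut_radiusM => //; exact: rP.
Qed.

(** Lifts satisfy the commutations modulo the center, which suffices for exact Heisenberg relations
    among the lifted commutators. Periodic points are then counted by [heisenberg_aut]. *)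
Lemma obstruction : exists r, forall N L (a e : G) (b c : nat -> G),
  let f j := [~ a, b j] in let g j := [~ c j, e] in let v j := [~ b j, g j] in
  1 < N ->
  (forall j, j < N -> GG (b j) /\ GG (c j)) ->
  word_ball S L a -> word_ball S L e ->
  word_ball S L (b 0%N) -> word_ball S L (c 0%N) ->
  (forall i, i < N -> [/\ commute a (f i), commute a (g i),
    commute e (g i), commute e (f i) & v i = v 0%N]) ->
  (forall i j, i < N -> j < N ->
    [/\ commute (b j) (f i), commute (c j) (g i) & i != j -> commute (c j) (f i)]) ->
  ~ center G [~ a, v 0%N] ->
  2 ^ N <= #|A| ^ ((r * L).*2.+1 ^ d).
Proof.
have [r rP] := lifts_radius.
(* From lifts of radius [r * L], the nested commutators [g' 0], [v' 0] and [k] get radii 4, 10 and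
   22 times as large. *)
exists (r * 22)%N => N L a e b c f g v N1 Gbc aL eL bL cL rel1 rel2 ncen.
have N0 : 0 < N by exact: ltnW.
have [a' la ra] := rP _ _ aL; have [e' le re] := rP _ _ eL.
have [b0 lb0 rb0] := rP _ _ bL; have [c0 lc0 rc0] := rP _ _ cL.
(* The short lift is kept at index 0, the only index that enters [k]; elsewhere any representative
   is taken. *)
have lex (h : nat -> G) h0 : (forall j, j < N -> GG (h j)) -> lifts (h 0%N) h0 ->
    exists h', h' 0%N = h0 /\ forall j, j < N -> lifts (h j) (h' j).
  move=> Gh lh0; exists (fun j => if j is 0 then h0 else repr (psi (h j))).
  split=> // -[//|j] jN; split; [exact: Gh | exact: coset_repr].
have [b' [b'0 lb]] := lex b b0 (fun j jN => (Gbc j jN).1) lb0.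
have [c' [c'0 lc]] := lex c c0 (fun j jN => (Gbc j jN).2) lc0.
pose f' j := [~ a', b' j]; pose g' j := [~ c' j, e'].
pose v' j := [~ b' j, g' j].
have lf j : j < N -> lifts (f j) (f' j) by move=> jN; apply: liftsR => //; exact: lb.
have lg j : j < N -> lifts (g j) (g' j) by move=> jN; apply: liftsR => //; exact: lc.
have lv j : j < N -> lifts (v j) (v' j).
  by move=> jN; apply: liftsR; [exact: lb | exact: lg].
pose k := [~ a', v' 0%N].
(* A noncentral element lies outside [K], so injectivity of [phi] keeps its image nontrivial. *)
have k1 : k != 1.
  apply/eqP => k1; have [Gk ek] := liftsR la (lv _ N0).
  apply: (coset_neq1 ncen); apply: phi_inj; rewrite ?inI //.
    exact: generated1.
  by rewrite -/(psi [~ a, v 0%N]) -/(psi 1) -ek -/k k1 psi1.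
have rk : aut_radius (r * 22 * L) k.
  have rg : aut_radius (r * L * 4) (g' 0%N).
    by rewrite /g' c'0; apply: aut_radius_mono (aut_radiusR rc0 re); lia.
  have rv : aut_radius (r * L * 10) (v' 0%N).
    by rewrite /v' b'0; apply: aut_radius_mono (aut_radiusR rb0 rg); lia.
  by apply: aut_radius_mono (aut_radiusR ra rv); nia.
have h1 i : i < N -> center H [~ a', f' i].
  by move=> iN; apply: lifts_commute (la) (lf i iN) _; have [] := rel1 i iN.
have h2 i j : i < N -> j < N -> center H [~ b' j, f' i].
  by move=> iN jN; apply: lifts_commute (lb j jN) (lf i iN) _; have [] := rel2 i j iN jN.
have h3 i j : i < N -> j < N -> center H [~ c' j, g' i].
  by move=> iN jN; apply: lifts_commute (lc j jN) (lg i iN) _; have [] := rel2 i j iN jN.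
have h4 i : i < N -> center H [~ e', g' i].
  by move=> iN; apply: lifts_commute (le) (lg i iN) _; have [] := rel1 i iN.
have h5 i j : i < N -> j < N -> i != j -> center H [~ c' j, f' i].
  move=> iN jN ij; apply: lifts_commute (lc j jN) (lf i iN) _.
  by have [_ _] := rel2 i j iN jN; apply.
have h6 i : i < N -> center H [~ e', f' i].
  by move=> iN; apply: lifts_commute (le) (lf i iN) _; have [] := rel1 i iN.
have h7 i : i < N -> center H [~ a', g' i].
  by move=> iN; apply: lifts_commute (la) (lg i iN) _; have [] := rel1 i iN.
have h8 i : i < N -> center H ((v' 0%N)^-1 * v' i).
  move=> iN; apply: lifts_eq (lv 0%N N0) _.
  by have [_ _ _ _ <-] := rel1 i iN; exact: lv.
apply: (@heisenberg_aut d A _ N f' g' k rk k1).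
- by move=> i iN; apply: (@lift_kappaC _ N a' e' b' c').
- by move=> i j iN jN; apply: (@lift_ff _ N a' b').
- by move=> i j iN jN ij; apply: (@lift_fg _ N a' e' b' c').
- by move=> i iN; apply: (@lift_fgk _ N a' e' b' c').
Qed.

End Obstruction.

(** * Frames and shears *)

Section Frames.
Local Open Scope ring_scope.
Variables (V : zmodType) (B : finType) (b0 b1 : B) (e : V) (r : nat).
Hypothesis b01 : b0 != b1.
Notation cfg := (config V B).
Implicit Types (x y : cfg) (u v : V) (t : nat) (f g : V -> bool).

(** The frame word reads [b0 b0 b1 ? b1 ? b1] and so on, each [?] being a cell for one bit, with
    [b1] for a set bit. *)
Definition fchar j (a : B) : bool :=
  if (j < 2)%N then a == b0
  else if odd j then (a == b0) || (a == b1) else a == b1.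

Definition frame x v : bool :=
  all (fun j => fchar j (x (v + e *+ j))) (iota 0 (r.*2 + 3)).

Definition bitpos t : V := e *+ (t.*2 + 3).

Definition bit t x v : bool := frame x v && (x (v + bitpos t) == b1).

Definition flip (a : B) : B :=
  if a == b0 then b1 else if a == b1 then b0 else a.

Definition toggle t f x : cfg := fun u =>
  if frame x (u - bitpos t) && f (u - bitpos t) then flip (x u) else x u.

Lemma flipK : involutive flip.
Proof.
move=> a; rewrite /flip; have [->|n0] := eqVneq a b0.
  by rewrite eqxx eq_sym (negPf b01).
have [->|n1] := eqVneq a b1; first by rewrite eqxx.
by rewrite (negPf n0) (negPf n1).
Qed.

Lemma flip0 : flip b0 = b1. Proof. by rewrite /flip eqxx. Qed.

Lemma flip1 : flip b1 = b0.
Proof. by rewrite /flip eqxx eq_sym (negPf b01). Qed.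

Lemma flip_fchar j a : (2 < j)%N -> odd j -> fchar j (flip a) = fchar j a.
Proof.
move=> j2 oj; rewrite /fchar oj ltnNge ltnW //= /flip.
have [->|n0] := eqVneq a b0; first by rewrite !eqxx orbT.
have [_|n1] := eqVneq a b1; first by rewrite eqxx.
by rewrite (negPf n0) (negPf n1).
Qed.

Lemma frameP x v :
  reflect (forall j, (j < r.*2 + 3)%N -> fchar j (x (v + e *+ j))) (frame x v).
Proof.
apply: (iffP allP) => h j.
  by move=> jr; apply: h; rewrite mem_iota.
by rewrite mem_iota => /andP[_ jr]; exact: h.
Qed.

(* A frame starts with two b0's, and inside a frame every other later cell is
   b1, so that no frame starts strictly inside another one. *)
Lemma frame_no_overlap x v o :
  frame x v -> frame x (v + e *+ o) -> (0 < o < r.*2 + 3)%N -> False.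
Proof.
move=> /frameP fv /frameP fw /andP[o0 or].
have w0 : x (v + e *+ o) = b0.
  by have := fw 0%N (ltn_addl _ _); rewrite /fchar /= addr0 => /(_ isT)/eqP.
have w1 : x (v + e *+ o.+1) = b0.
  have := fw 1%N; rewrite -addrA -mulrnDr addn1 /fchar /= => h.
  by apply/eqP/h; lia.
have even j : (2 <= j < r.*2 + 3)%N -> ~~ odd j -> x (v + e *+ j) = b1.
  move=> /andP[j2 jr] oj; have := fv j jr; rewrite /fchar ltnNge j2 (negPf oj).
  by move/eqP.
have [oo|oo] := boolP (odd o).
  by move/eqP: b01; apply; rewrite -w1 even //; lia.
by move/eqP: b01; apply; rewrite -w0 even //; lia.
Qed.

Lemma frame_inj x v w i j : frame x v -> frame x w ->
  (i < r.*2 + 3)%N -> (j < r.*2 + 3)%N -> v + e *+ i = w + e *+ j -> i = j.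
Proof.
have step v' w' i' j' : frame x v' -> frame x w' -> (j' < r.*2 + 3)%N ->
    v' + e *+ i' = w' + e *+ j' -> (i' < j')%N -> False.
  move=> fv fw jr E ij; have vE : v' = w' + e *+ (j' - i').
    by rewrite mulrnBr ?(ltnW ij) // addrA -E addrK.
  by apply: (@frame_no_overlap x w' (j' - i')); rewrite -?vE //; lia.
move=> fv fw ir jr E; case: (ltngtP i j) => // ij.
  by case: (step v w i j).
by case: (step w v j i).
Qed.

Lemma bitpos_lt t : (t < r)%N -> (t.*2 + 3 < r.*2 + 3)%N.
Proof. by lia. Qed.

Lemma toggle_sub t f x v j : (t < r)%N -> frame x v -> (j < r.*2 + 3)%N ->
  j != (t.*2 + 3)%N -> toggle t f x (v + e *+ j) = x (v + e *+ j).
Proof.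
move=> tr fv jr jt; rewrite /toggle; case: ifP => // /andP[fw _].
case/eqP: jt; apply: (frame_inj fv fw jr (bitpos_lt tr)).
by rewrite /bitpos subrK.
Qed.

Lemma toggle_bit t f x v :
  toggle t f x (v + bitpos t) =
  if frame x v && f v then flip (x (v + bitpos t)) else x (v + bitpos t).
Proof. by rewrite /toggle addrK. Qed.

Lemma toggle_frame_sub t f x v : (t < r)%N -> frame x v -> frame (toggle t f x) v.
Proof.
move=> tr fv; apply/frameP => j jr; have /frameP/(_ j jr) fj := fv.
have [->|jt] := eqVneq j (t.*2 + 3)%N; last by rewrite toggle_sub.
rewrite -/(bitpos t) toggle_bit; case: ifP => _; last by apply/(frameP _ _ fv)/bitpos_lt.
rewrite flip_fchar; [exact/(frameP _ _ fv)/bitpos_lt | lia | lia].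
Qed.

(** No frame is created: a changed cell of a new frame would lie in an old frame, which survives the
    toggle, and two frames sharing a cell coincide. *)
Lemma frame_toggle t f x : (t < r)%N -> frame (toggle t f x) = frame x.
Proof.
move=> tr; apply/funext => v; apply/idP/idP; last exact: toggle_frame_sub.
move=> fv; have [[j /andP[jr ne]]|same] :=
    pselect (exists j, (j < r.*2 + 3)%N && (toggle t f x (v + e *+ j) != x (v + e *+ j))).
  move: ne; rewrite {1}/toggle; case: ifP => [/andP[fw _] _|]; last by rewrite eqxx.
  have fw' := toggle_frame_sub f tr fw.
  have E : v + e *+ j = v + e *+ j - bitpos t + e *+ (t.*2 + 3) by rewrite subrK.
  have jt := frame_inj fv fw' jr (bitpos_lt tr) E.
  by move: fw; rewrite jt addrK.
apply/frameP => j jr; have /frameP/(_ j jr) := fv.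
suff -> : toggle t f x (v + e *+ j) = x (v + e *+ j) by [].
by apply/eqP/negPn/negP => ne; apply: same; exists j; rewrite jr.
Qed.

Lemma toggle_eq t f g x : (forall v, frame x v -> f v = g v) ->
  toggle t f x = toggle t g x.
Proof.
move=> fg; apply/funext => u; rewrite /toggle.
by case: (boolP (frame x _)) => //= /fg ->.
Qed.

Lemma toggle0 t x : toggle t (fun _ => false) x = x.
Proof. by apply/funext => u; rewrite /toggle andbF. Qed.

Lemma toggleD t f g x : (t < r)%N ->
  toggle t f (toggle t g x) = toggle t (fun v => f v (+) g v) x.
Proof.
move=> tr; apply/funext => u; rewrite {1}/toggle frame_toggle // /toggle.
case: (boolP (frame x _)) => //= _.
by case: (f _); case: (g _) => //=; rewrite flipK.
Qed.

Lemma toggleK t f x : (t < r)%N -> toggle t f (toggle t f x) = x.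
Proof.
move=> tr; rewrite toggleD // (_ : (fun _ => _) = (fun _ => false)) ?toggle0 //.
by apply/funext => v; rewrite addbb.
Qed.

Lemma toggleC t s f g x : (t < r)%N -> (s < r)%N ->
  toggle t f (toggle s g x) = toggle s g (toggle t f x).
Proof.
move=> tr sr; apply/funext => u; rewrite /toggle !(frame_toggle _ _ tr, frame_toggle _ _ sr).
by case: ifP; case: ifP.
Qed.

Lemma bit_toggle t f x v : (t < r)%N ->
  bit t (toggle t f x) v = bit t x v (+) (frame x v && f v).
Proof.
move=> tr; rewrite /bit frame_toggle // toggle_bit.
have [fv|//] := boolP (frame x v); rewrite /=.
case: (f v); last by rewrite addbF.
have /frameP/(_ _ (bitpos_lt tr)) := fv.
rewrite -/(bitpos t) /fchar (_ : (_ < 2)%N = false); last by lia.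
rewrite (_ : odd _ = true); last by lia.
by case/orP=> /eqP->; rewrite ?flip0 ?flip1 eqxx (negPf b01).
Qed.

Lemma bit_toggle_neq t s f x : (t < r)%N -> (s < r)%N -> t != s ->
  bit s (toggle t f x) = bit s x.
Proof.
move=> tr sr ts; apply/funext => v; rewrite /bit frame_toggle //.
have [fv|//] := boolP (frame x v); rewrite /= toggle_sub ?bitpos_lt //.
by apply: contra_neq ts; lia.
Qed.

Lemma bit_frame t x v : bit t x v -> frame x v.
Proof. by case/andP. Qed.

Lemma frame_shift w x v : frame (shift w x) v = frame x (v - w).
Proof.
by apply: eq_all => j; rewrite /shift addrA [- w + v]addrC.
Qed.

Lemma toggle_shift t f w x :
  toggle t (fun v => f (v - w)) (shift w x) = shift w (toggle t f x).
Proof.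
apply/funext => u; rewrite /toggle /shift frame_shift.
by rewrite (_ : u - bitpos t - w = - w + u - bitpos t) // addrC addrA.
Qed.

End Frames.

(** * Fibonacci polynomials over the field with two elements *)

Section Fibonacci.
Variable T : Type.
Notation fld := (T -> bool).
Implicit Types p q : fld.

Definition fadd p q : fld := fun v => p v (+) q v.

Lemma faddACA p q s t : fadd (fadd p q) (fadd s t) = fadd (fadd p s) (fadd q t).
Proof. by apply/funext => v; rewrite /fadd addbACA. Qed.

Definition fadditive (A : fld -> fld) := forall p q, A (fadd p q) = fadd (A p) (A q).

Lemma fadditive_iter A n : fadditive A -> fadditive (iter n A).
Proof. by move=> addA p q; elim: n => //= n ->. Qed.

Definition fib_step (A : fld -> fld) (pq : fld * fld) : fld * fld :=
  (fadd (A pq.1) pq.2, pq.1).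

(* The coefficients are Fibonacci polynomials in A; modulo 2 the 2^k-th one is
   the monomial A^(2^k - 1). *)
Lemma fib_pow2 A k : fadditive A ->
  exists Q, [/\ fadditive Q, forall p, Q (A p) = A (Q p) &
    forall p q, iter (2 ^ k) (fib_step A) (p, q) =
      (fadd (fadd (iter (2 ^ k) A p) (Q p)) (iter (2 ^ k).-1 A q),
       fadd (iter (2 ^ k).-1 A p) (Q q))].
Proof.
move=> addA; elim: k => [|k [Q [addQ QA fQ]]].
  exists (fun _ _ => false); split.
  - by move=> p q; apply/funext.
  - move=> p; apply/funext => v; set o := fun _ => false.
    have : A (fadd o o) v = false by rewrite addA /fadd addbb.
    by rewrite (_ : fadd o o = o) //; apply/funext.
  - move=> p q; rewrite /= /fib_step /=; congr (_, _); apply/funext => v;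
    by rewrite /fadd ?addbF.
have QAn n p : Q (iter n A p) = iter n A (Q p).
  by elim: n => //= n <-; rewrite QA.
set n := (2 ^ k)%N in fQ *; have n0 : (0 < n)%N by rewrite expn_gt0.
have addAn m := fadditive_iter m addA.
(* [Q] is the Fibonacci polynomial of index [n - 1], and the witness is the doubling identity
   F(2n-1) = F(n-1)^2 + F(n)^2 with F(n) = A^(n-1). *)
exists (fun p => fadd (Q (Q p)) (iter (n.-1 + n.-1) A p)); split.
- by move=> p q; rewrite !addQ addAn faddACA.
- by move=> p; rewrite !QA -iterSr iterS addA.
- move=> p q; rewrite expnS mul2n -addnn -/n iterD !fQ.
  have -> : (n + n).-1 = (n + n.-1)%N by lia.
  rewrite !addAn !addQ !QAn !iterD.
  have e m : iter n.-1 A (iter n A m) = iter n A (iter n.-1 A m).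
    by rewrite -!iterD addnC.
  congr (_, _); apply/funext => v; rewrite /fadd ?e;
  move: (iter n A (iter n A p) v) (iter n A (Q p) v) (iter n A (iter n.-1 A q) v)
    (Q (Q p) v) (iter n.-1 A (Q q) v) (iter n.-1 A (iter n.-1 A p) v)
    (iter n A (iter n.-1 A p) v) (iter n.-1 A (Q p) v)
    (iter n.-1 A (iter n.-1 A q) v) (Q (Q q) v);
  by do 10!case.
Qed.

End Fibonacci.

(** * The calculus of shears *)

Section Shears.
Local Open Scope ring_scope.
Variables (V : zmodType) (B : finType) (b0 b1 : B) (e : V) (r : nat).
Hypothesis b01 : b0 != b1.
Notation cfg := (config V B).
Notation G := (AutShift V B).
Notation fld := (V -> bool).
Local Notation frame := (frame b0 b1 e r).
Local Notation bit := (bit b0 b1 e r).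
Local Notation toggle := (toggle b0 b1 e r).
Implicit Types (x y : cfg) (u v : V) (s t c : nat) (g h : G).
Implicit Types (phi psi : cfg -> fld).

Definition shear_of h t phi : Prop := forall x, h x = toggle t (phi x) x.

Definition indep t phi : Prop := forall f x, phi (toggle t f x) = phi x.

(** The local rules of sliding block codes. *)
Definition window_rule phi : Prop :=
  (forall w x v, phi (shift w x) v = phi x (v - w)) /\
  (exists D, forall x y, agree D x y -> phi x 0 = phi y 0).

Lemma window_rule_at phi v : window_rule phi ->
  exists D, forall x y, agree D x y -> phi x v = phi y v.
Proof.
move=> [eq [D loc]]; exists [seq u + v | u <- D] => x y xy.
have E z : phi z v = phi (shift (- v) z) 0 by rewrite eq opprK add0r.
rewrite !E; apply: loc => u uD; rewrite /shift opprK addrC.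
by apply: xy; exact: map_f.
Qed.

Lemma wr_const b : window_rule (fun _ _ => b).
Proof. by split=> //; exists [::]. Qed.

Lemma wr_op2 (op : bool -> bool -> bool) phi psi :
  window_rule phi -> window_rule psi ->
  window_rule (fun x v => op (phi x v) (psi x v)).
Proof.
move=> [e1 [D l1]] [e2 [E l2]]; split=> [w x v|]; first by rewrite e1 e2.
exists (D ++ E) => x y xy; rewrite (l1 x y) ?(l2 x y) // => v vD; apply: xy;
by rewrite mem_cat vD ?orbT.
Qed.

Lemma wr_neg phi : window_rule phi -> window_rule (fun x v => ~~ phi x v).
Proof.
move=> [e1 [D l1]]; split=> [w x v|]; first by rewrite e1.
by exists D => x y /l1 ->.
Qed.

Lemma wr_at phi u : window_rule phi -> window_rule (fun x v => phi x (v + u)).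
Proof.
move=> wr; split; first by move=> w x v; rewrite wr.1 addrAC.
by have [D] := window_rule_at (0 + u) wr; exists D.
Qed.

Lemma wr_all (I : Type) (l : seq I) (F : I -> cfg -> fld) :
  (forall i, window_rule (F i)) -> window_rule (fun x v => all (fun i => F i x v) l).
Proof.
move=> wF; elim: l => [|i l IH] /=; first exact: wr_const.
exact: wr_op2 (wF i) IH.
Qed.

Lemma wr_sym (p : pred B) : window_rule (fun x v => p (x v)).
Proof.
split=> [w x v|]; first by rewrite /shift addrC.
by exists [:: 0] => x y ->; rewrite ?mem_head.
Qed.

Lemma wr_frame : window_rule frame.
Proof.
apply: (@wr_all _ _ (fun j x v => fchar b0 b1 j (x (v + e *+ j)))) => j.
exact: wr_at (wr_sym _).
Qed.

Lemma wr_bit t : window_rule (bit t).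
Proof. by apply: wr_op2 wr_frame _; apply: wr_at (wr_sym (pred1 b1)). Qed.

Lemma shear_ex t phi : (t < r)%N -> window_rule phi -> indep t phi ->
  exists h, shear_of h t phi.
Proof.
move=> tr wr ind; pose F : cfg -> cfg := fun x => toggle t (phi x) x.
have FK : cancel F F by move=> x; rewrite /F ind toggleK.
have cF : continuous F.
  apply: local_continuous => u.
  have [D1 l1] := window_rule_at (u - bitpos e t) wr.
  have [D2 l2] := window_rule_at (u - bitpos e t) wr_frame.
  exists (u :: D1 ++ D2) => x y xy; rewrite /F /toggle.
  rewrite (xy u (mem_head _ _)) (l1 x y) ?(l2 x y) // => w wD; apply: xy;
  by rewrite inE mem_cat wD ?orbT.
have hF : homeomorphism F by split=> //; exists F.
have eF : equivariant F.
  move=> w x; rewrite /F -toggle_shift; congr (toggle t _ _).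
  by apply/funext => v; rewrite wr.1.
by exists (mkAut hF eF).
Qed.

Lemma shear_uniq g h t phi : shear_of g t phi -> shear_of h t phi -> g = h.
Proof. by move=> sg sh; apply: aut_eq => x; rewrite sg sh. Qed.

Lemma shear_ext h t phi psi :
  (forall x v, frame x v -> phi x v = psi x v) ->
  shear_of h t phi -> shear_of h t psi.
Proof. by move=> pq sh x; rewrite sh; apply: toggle_eq => v; exact: pq. Qed.

Lemma shear_invol h t phi : (t < r)%N -> indep t phi -> shear_of h t phi -> h^-1%g = h.
Proof.
move=> tr ind sh; apply: mulg1_eq; apply: aut_eq => x.
by change (h (h x) = x); rewrite !sh ind toggleK.
Qed.

(* A commutator of shears composes their rules: transvections
   [E_tc(O), E_cd(O')] = E_td(O O'). *)
Lemma shear_comp g h t c (O : cfg -> fld -> fld) psi :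
  (t < r)%N -> (c < r)%N -> t != c ->
  (forall x, fadditive (O x)) ->
  (forall f x, O (toggle t f x) = O x) -> (forall f x, O (toggle c f x) = O x) ->
  indep t psi -> indep c psi ->
  shear_of g t (fun x => O x (bit c x)) -> shear_of h c psi ->
  shear_of [~ g, h]%g t (fun x => O x (fun v => frame x v && psi x v)).
Proof.
move=> tr cr tc Oadd Ot Oc it ic sg sh.
have ig : indep t (fun x => O x (bit c x)) by move=> f x; rewrite Ot bit_toggle_neq.
rewrite commgEl conjgE (shear_invol tr ig sg) (shear_invol cr ic sh) => x.
change (g (h (g (h x))) = toggle t (O x (fun v => frame x v && psi x v)) x).
rewrite [h x]sh [g (toggle c _ _)]sg [h _]sh it ic.
rewrite [toggle c (psi x) (toggle t _ _)]toggleC // toggleK //.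
rewrite sg Ot bit_toggle_neq // Oc toggleD //; apply: toggle_eq => v fv.
have -> : bit c (toggle c (psi x) x) =
    fadd (bit c x) (fun v => frame x v && psi x v).
  by apply/funext => u; rewrite bit_toggle.
by rewrite Oadd /fadd addKb.
Qed.

(** Each rule has to be insensitive only to the actual toggle of the other shear, not to every
    toggle of that bit. The isolation of certified boxes gives just this weaker condition. *)
Lemma shear_commute g h t c phi psi :
  (t < r)%N -> (c < r)%N ->
  shear_of g t phi -> shear_of h c psi ->
  (forall x v, frame x v -> phi (toggle c (psi x) x) v = phi x v) ->
  (forall x v, frame x v -> psi (toggle t (phi x) x) v = psi x v) ->
  commute g h.
Proof.
move=> tr cr sg sh pc pt; apply: aut_eq => x.
change (g (h x) = h (g x)); rewrite [h x]sh [g x]sg sg sh.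
rewrite (@toggle_eq _ _ _ _ _ _ t _ (phi x)); last first.
  by move=> v; rewrite frame_toggle // => /pc.
rewrite [in RHS](@toggle_eq _ _ _ _ _ _ c _ (psi x)); last first.
  by move=> v; rewrite frame_toggle // => /pt.
exact: toggleC.
Qed.

Definition blind t (h : G) : Prop := forall f x, h (toggle t f x) = toggle t f (h x).

Lemma blind_shear h t c phi : (t < r)%N -> (c < r)%N -> indep t phi ->
  shear_of h c phi -> blind t h.
Proof. by move=> tr cr it sh f x; rewrite !sh it toggleC. Qed.

Lemma blindM t g h : blind t g -> blind t h -> blind t (g * h)%g.
Proof.
move=> bg bh f x; change (g (h (toggle t f x)) = toggle t f (g (h x))).
by rewrite bh bg.
Qed.

Lemma blindX t g n : blind t g -> blind t (g ^+ n)%g.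
Proof. by move=> bg; elim: n => // n IH; rewrite expgS; exact: blindM. Qed.

(** Conjugation lets [k] prepare data on other bits, [g] read it, and [k] be undone, without
    disturbing the output bit [t]. *)
Lemma shear_conj g k t phi : blind t k -> shear_of g t phi ->
  shear_of (g ^ k)%g t (fun x => phi (k x)).
Proof.
move=> bk sg x; have kK : cancel k (aut_fun k^-1%g).
  by move=> y; change (aut_fun (k^-1 * k)%g y = y); rewrite mulVg.
change (aut_fun k^-1%g (g (k x)) = toggle t (phi (k x)) x).
by rewrite sg -bk kK.
Qed.

End Shears.

(** * Families of shears given by words of linear length *)

Section LinearFamilies.
Local Open Scope ring_scope.
Variables (V : zmodType) (B : finType) (b0 b1 : B) (e : V) (r : nat).
Hypothesis b01 : b0 != b1.
Notation cfg := (config V B).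
Notation G := (AutShift V B).
Notation fld := (V -> bool).
Local Notation frame := (frame b0 b1 e r).
Local Notation bit := (bit b0 b1 e r).
Local Notation toggle := (toggle b0 b1 e r).
Local Notation shear_of := (@shear_of V B b0 b1 e r).
Local Notation indep := (@indep V B b0 b1 e r).
Local Notation blind := (@blind V B b0 b1 e r).
Implicit Types (x y : cfg) (u v : V) (t c : nat) (g h : G).
Variable S : set G.
Hypothesis S_inv : forall h, S h -> S (h^-1)%g.

Lemma word_ballV L g : word_ball S L g -> word_ball S L g^-1%g.
Proof.
case=> l [lL lS ->]; exists (rev [seq h^-1%g | h <- l]).
rewrite size_rev size_map; split=> //.
  move=> h; rewrite mem_rev => /mapP[k kl ->]; exact/S_inv/lS.
elim: l {lL lS} => [|h l IH]; first by rewrite !big_nil invg1.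
by rewrite big_cons invgM IH /= rev_cons -cats1 big_cat big_seq1.
Qed.

Lemma word_ballR L M g h : word_ball S L g -> word_ball S M h ->
  word_ball S (L + M).*2 [~ g, h]%g.
Proof.
move=> wg wh; have -> : [~ g, h]%g = ((g^-1 * h^-1) * (g * h))%g.
  by rewrite commgEl conjgE !mulgA.
by rewrite -addnn; apply: word_ballM; apply: word_ballM => //; exact: word_ballV.
Qed.

Definition gen t (phi : cfg -> fld) : Prop := exists2 h, S h & shear_of h t phi.

(** Here [2 ^ k] is the side of the box, and the constant is uniform in [k]. *)
Definition lin_family t (phi : nat -> cfg -> fld) : Prop :=
  exists C, forall k, exists2 g, word_ball S (C * 2 ^ k) g & shear_of g t (phi k).

Lemma lin_gen t phi : gen t phi -> lin_family t (fun _ => phi).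
Proof.
case=> h Sh sh; exists 1%N => k; exists h => //.
by apply: word_ball_mono (word_ball_gen Sh); rewrite mul1n expn_gt0.
Qed.

Lemma lin_ext t phi psi :
  (forall k x v, frame x v -> phi k x v = psi k x v) ->
  lin_family t phi -> lin_family t psi.
Proof.
move=> pq [C CP]; exists C => k; have [g wg sg] := CP k; exists g => //.
by apply: shear_ext sg; exact: pq.
Qed.

Lemma lin_comp t c (O : nat -> cfg -> fld -> fld) psi :
  (t < r)%N -> (c < r)%N -> t != c ->
  (forall k x, fadditive (O k x)) ->
  (forall k f x, O k (toggle t f x) = O k x) ->
  (forall k f x, O k (toggle c f x) = O k x) ->
  (forall k, indep t (psi k)) -> (forall k, indep c (psi k)) ->
  lin_family t (fun k x => O k x (bit c x)) -> lin_family c psi ->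
  lin_family t (fun k x => O k x (fun v => frame x v && psi k x v)).
Proof.
move=> tr cr tc Oadd Ot Oc it ic [C1 P1] [C2 P2].
exists (C1 + C2).*2 => k; have [g wg sg] := P1 k; have [h wh sh] := P2 k.
exists [~ g, h]%g.
  by rewrite -doubleMl mulnDl; exact: word_ballR.
exact: (shear_comp b01 tr cr tc (Oadd k) (Ot k) (Oc k) (it k) (ic k) sg sh).
Qed.

Lemma lin_conj t c phi psi :
  (t < r)%N -> (c < r)%N -> (forall k, indep t (psi k)) ->
  lin_family t phi -> lin_family c psi ->
  lin_family t (fun k x => phi k (toggle c (psi k x) x)).
Proof.
move=> tr cr it [C1 P1] [C2 P2]; exists (C2 + (C1 + C2))%N => k.
have [g wg sg] := P1 k; have [h wh sh] := P2 k.
exists (g ^ h)%g.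
  rewrite conjgE !mulnDl; apply: word_ballM; first exact: word_ballV.
  exact: word_ballM.
have := shear_conj (blind_shear b01 tr cr (it k) sh) sg.
by apply: shear_ext => x v _; rewrite sh.
Qed.

Section Run.
Variables (A : cfg -> fld -> fld) (a b c d : nat).
Hypotheses (ar : (a < r)%N) (br : (b < r)%N) (cr : (c < r)%N) (dr : (d < r)%N).
Hypotheses (ab : a != b) (ac : a != c) (bc : b != c) (bd : b != d) (cd : c != d).
Hypothesis Aadd : forall x, fadditive (A x).
Hypothesis Asup : forall x p v, ~~ frame x v -> A x p v = false.
Hypothesis Aa : forall f x, A (toggle a f x) = A x.
Hypothesis Ab : forall f x, A (toggle b f x) = A x.
Hypothesis Ac : forall f x, A (toggle c f x) = A x.
Hypotheses (gA : gen b (fun x => A x (bit a x))) (gab : gen a (bit b))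
  (gba : gen b (bit a)) (gca : gen c (bit a)) (gbd : gen b (bit d)).

Let bitsE t f x : (t < r)%N ->
  bit t (toggle t f x) = fadd (bit t x) (fun v => frame x v && f v).
Proof. by move=> tr; apply/funext => v; rewrite bit_toggle. Qed.

Let frame_bit t x : (fun v => frame x v && bit t x v) = bit t x.
Proof.
by apply/funext => v; case: (boolP (bit t x v)); rewrite ?andbF // => /bit_frame ->.
Qed.

Let frame_A x p : (fun v => frame x v && A x p v) = A x p.
Proof.
by apply/funext => v; case: (boolP (frame x v)) => //= /(Asup p) ->.
Qed.

(* R realizes (p, q) |-> (A p + q, p) on the tracks a and b. *)
Lemma run_step : exists R : G, [/\ word_ball S 4 R, blind c R &
  forall x, [/\ A (R x) = A x, frame (R x) = frame x &
  (bit a (R x), bit b (R x)) = fib_step (A x) (bit a x, bit b x)]].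
Proof.
have [g Sg sg] := gA; have [h1 Sh1 s1] := gab; have [h2 Sh2 s2] := gba.
(* First [g] adds [A] of track [a] to track [b]; the three additions that follow swap the tracks
   modulo 2. *)
exists (h1 * (h2 * (h1 * g)))%g; split.
- have w := @word_ball_gen _ S.
  by do 3![apply: (@word_ballM _ S 1); first exact: w]; exact: w.
- have i1 : blind c h1.
    by apply: (blind_shear b01 cr ar _ s1) => f x; rewrite bit_toggle_neq // eq_sym.
  have i2 : blind c h2.
    by apply: (blind_shear b01 cr br _ s2) => f x; rewrite bit_toggle_neq // eq_sym.
  have i3 : blind c g.
    by apply: (blind_shear b01 cr br _ sg) => f x; rewrite Ac bit_toggle_neq // eq_sym.
  by do !apply: blindM.
move=> x; change (aut_fun (h1 * (h2 * (h1 * g)))%g x) with (h1 (h2 (h1 (g x)))).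
set x1 := g x; set x2 := h1 x1; set x3 := h2 x2; set x4 := h1 x3.
have ba : b != a by rewrite eq_sym.
have a1 : bit a x1 = bit a x by rewrite /x1 sg bit_toggle_neq.
have b1' : bit b x1 = fadd (bit b x) (A x (bit a x)).
  by rewrite /x1 sg bitsE // frame_A.
have a2 : bit a x2 = fadd (bit a x1) (bit b x1).
  by rewrite /x2 s1 bitsE // frame_bit.
have b2 : bit b x2 = bit b x1 by rewrite /x2 s1 bit_toggle_neq.
have a3 : bit a x3 = bit a x2 by rewrite /x3 s2 bit_toggle_neq.
have b3 : bit b x3 = fadd (bit b x2) (bit a x2).
  by rewrite /x3 s2 bitsE // frame_bit.
have a4 : bit a x4 = fadd (bit a x3) (bit b x3).
  by rewrite /x4 s1 bitsE // frame_bit.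
have b4 : bit b x4 = bit b x3 by rewrite /x4 s1 bit_toggle_neq.
split.
- by rewrite /x4 s1 Aa /x3 s2 Ab /x2 s1 Aa /x1 sg Ab.
- by rewrite /x4 s1 frame_toggle // /x3 s2 frame_toggle // /x2 s1 frame_toggle // /x1 sg frame_toggle.
- rewrite /fib_step /= a4 b4 b3 a3 a2 b2 a1 b1'.
  congr (_, _); apply/funext => v; rewrite /fadd;
  by case: (bit a x v); case: (bit b x v); case: (A x _ v).
Qed.

(** Conjugating [h] by [R ^+ n] adds to [c] a combination of tracks [a] and [b] in which [b] has
    coefficient [A ^ (n - 1)], for [n = 2 ^ k]. The commutator with the addition of [d] to [b]
    retains only the resulting difference, so the unknown contents of [a] and [b] cancel. *)
Lemma lin_run : lin_family c (fun k x => iter (2 ^ k).-1 (A x) (bit d x)).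
Proof.
have [R [wR cR RP]] := run_step.
have [h Sh sh] := gca; have [h' Sh' sh'] := gbd.
have RX n x : [/\ A (aut_fun (R ^+ n)%g x) = A x &
    (bit a (aut_fun (R ^+ n)%g x), bit b (aut_fun (R ^+ n)%g x)) =
    iter n (fib_step (A x)) (bit a x, bit b x)].
  elim: n x => // n IH x; rewrite expgSr.
  change (aut_fun (R ^+ n * R)%g x) with (aut_fun (R ^+ n)%g (R x)).
  have [IH1 IH2] := IH (R x); have [AR _ bR] := RP x.
  by rewrite IH1 IH2 AR bR -iterSr.
exists ((4 + (1 + 4)) + 1).*2 => k.
set n := (2 ^ k)%N; pose F : G := (h ^ (R ^+ n))%g.
have wF : word_ball S (4 * n + (1 + 4 * n)) F.
  have wRn := word_ballX n wR.
  rewrite /F conjgE; apply: word_ballM; first exact: word_ballV.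
  by apply: word_ballM => //; exact: word_ball_gen.
have sF : shear_of F c (fun x => bit a (aut_fun (R ^+ n)%g x)).
  exact: shear_conj (blindX n cR) sh.
exists [~ F, h']%g.
  have := word_ballR wF (word_ball_gen Sh'); apply: word_ball_mono.
  have : (0 < n)%N by rewrite expn_gt0.
  by move: (n) => N; lia.
pose O x p := fst (iter n (fib_step (A x)) (bit a x, p)).
have bE x : bit a (aut_fun (R ^+ n)%g x) = O x (bit b x).
  by rewrite /O -(RX n x).2.
have iF : indep c (fun x => bit a (aut_fun (R ^+ n)%g x)).
  by move=> f x; rewrite (blindX n cR) bit_toggle_neq // eq_sym.
have ih' : indep b (bit d) by move=> f x; rewrite bit_toggle_neq.
have ih'c : indep c (bit d) by move=> f x; rewrite bit_toggle_neq.
have FV := shear_invol b01 cr iF sF; have hV := shear_invol b01 br ih' sh'.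
rewrite commgEl conjgE FV hV => x.
change (F (h' (F (h' x))) = toggle c (iter n.-1 (A x) (bit d x)) x).
rewrite [h' x]sh' [F (toggle b _ _)]sF [h' _]sh' ih'c ih'.
rewrite [toggle b (bit d x) (toggle c _ _)]toggleC // toggleK //.
rewrite sF iF toggleD //; apply: toggle_eq => v fv.
have [Q [_ _ fQ]] := fib_pow2 k (Aadd x).
rewrite !bE /O Ab -/n !fQ /= bit_toggle_neq //; last by rewrite eq_sym.
rewrite bitsE // frame_bit (fadditive_iter _ (Aadd x)) /fadd.
rewrite -/n; case: (iter n _ _ v); case: (Q _ v); case: (iter _ _ (bit b x) v);
by case: (iter _ _ (bit d x) v).
Qed.

End Run.
End LinearFamilies.

(** * Certified boxes *)

Definition digit n j k := ((j %/ n ^ k) %% n)%N.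

Lemma digit_inj n m j j' : (j < n ^ m)%N -> (j' < n ^ m)%N ->
  (forall k, (k < m)%N -> digit n j k = digit n j' k) -> j = j'.
Proof.
elim: m j j' => [|m IH] j j' jn jn' h.
  by move: jn jn'; rewrite expn0; case: j {h} => //; case: j'.
have n0 : (0 < n)%N by rewrite lt0n; apply: contraTneq jn => ->; rewrite exp0n.
have dS i k : digit n i k.+1 = digit n (i %/ n) k.
  by rewrite /digit expnS divnMA.
rewrite (divn_eq j n) (divn_eq j' n); congr (_ * _ + _)%N.
  apply: IH; rewrite ?ltn_divLR -?expnSr // => k km.
  by rewrite -!dS h.
by have := h 0%N isT; rewrite /digit expn0 !divn1.
Qed.

Section Construction.
Local Open Scope ring_scope.
Variables (V : zmodType) (B : finType) (b0 b1 : B) (e : V) (D : nat) (eps : nat -> V).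
Hypothesis b01 : b0 != b1.
Hypothesis D_gt0 : (0 < D)%N.
Notation r := (D.*2 + 6)%N.
Notation cfg := (config V B).
Notation G := (AutShift V B).
Notation fld := (V -> bool).
Local Notation frame := (frame b0 b1 e r).
Local Notation bit := (bit b0 b1 e r).
Local Notation toggle := (toggle b0 b1 e r).
Local Notation shear_of := (@shear_of V B b0 b1 e r).
Local Notation indep := (@indep V B b0 b1 e r).
Implicit Types (x y : cfg) (v w : V) (u : nat -> nat) (t c d : nat) (g h : G).

(* Bit i < D is the face label (whether the i-th box coordinate is 0), bit D + i is the
   carry read by level i, and the six bits lin j are the linear tracks. *)
Definition lin j := (D.*2 + j)%N.

(** Guards the step from [v - eps i] to [v]. Constancy of the higher labels spreads each face label
    over the directions already checked. *)
Definition alpha i x v : bool :=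
  [&& bit (D + i) x v, bit (D + i) x (v - eps i), ~~ bit i x v &
      all (fun k => bit k x v == bit k x (v - eps i)) (iota i.+1 (D - i.+1))].

Definition beta i x v : bool :=
  ~~ bit (D + i) x v && ~~ bit (D + i) x (v - eps i).

Definition fwd i x (p : fld) : fld :=
  fun v => [&& frame x v, alpha i x v & p (v - eps i)].

Definition bwd i x (p : fld) : fld :=
  fun v => [&& frame x v, beta i x (v + eps i) & p (v + eps i)].

Definition rule (k i d : nat) : cfg -> fld :=
  match k with
  | 0 => bit d
  | 1 => fun x v => bit i x v && bit d x v
  | 2 => fun x => fwd i x (bit d x)
  | 3 => fun x => bwd i x (bit d x)
  | 4 => fun x v => frame x v && bit d x (v + eps i)
  | 5 => fun x v => frame x v && bit d x (v - eps i)
  | _ => frame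
  end.

Definition gens : set G := [set h | exists t k i d,
  [/\ (t < r)%N && (k < 7)%N && (i < D)%N && (d < r)%N,
      indep t (rule k i d) & shear_of h t (rule k i d)]]%classic.

(** A shear is determined by its bit and its rule, hence by four bounded indices. *)
Lemma finite_gens : finite_set gens.
Proof.
pose F (q : 'I_r * 'I_7 * 'I_D * 'I_r) : G := xget 1%g
  [set h | shear_of h q.1.1.1 (rule q.1.1.2 q.1.2 q.2)]%classic.
apply: (@sub_finite_set _ _ (F @` setT)%classic); last exact/finite_image/finite_finset.
move=> h [t [k [i [d [/andP[/andP[/andP[tr k7] iD] dr] _ sh]]]]].
exists (Ordinal tr, Ordinal k7, Ordinal iD, Ordinal dr) => //; rewrite /F /=.
by case: xgetP => [g _ /= sg|/(_ h)//]; exact: shear_uniq sg sh.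
Qed.

Lemma gens_inv h : gens h -> gens h^-1%g.
Proof.
move=> [t [k [i [d [b ind sh]]]]]; move: (b) => /andP[/andP[/andP[tr _] _] _].
by rewrite (shear_invol b01 tr ind sh); exists t, k, i, d.
Qed.

Lemma wr_rule k i d : window_rule (rule k i d).
Proof.
have wb j : window_rule (bit j) by exact: wr_bit.
have wf : window_rule frame by exact: wr_frame.
have wa : window_rule (alpha i).
  apply: wr_op2 (wb _) _; apply: wr_op2 (wr_at _ (wb _)) _.
  apply: wr_op2 (wr_neg (wb _)) _; apply: wr_all => j.
  exact: (wr_op2 (fun p q => p == q) (wb _) (wr_at _ (wb _))).
have wbe : window_rule (beta i).
  exact: wr_op2 (wr_neg (wb _)) (wr_neg (wr_at _ (wb _))).
case: k => [|[|[|[|[|[|k]]]]]] //=.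
- exact: wr_op2.
- exact: (wr_op2 andb wf (wr_op2 andb wa (wr_at _ (wb _)))).
- exact: (wr_op2 andb wf (wr_op2 andb (wr_at _ wbe) (wr_at _ (wb _)))).
- exact: (wr_op2 andb wf (wr_at _ (wb _))).
- exact: (wr_op2 andb wf (wr_at _ (wb _))).
Qed.

Local Notation gen := (@gen V B b0 b1 e r gens).
Local Notation lin_family := (@lin_family V B b0 b1 e r gens).

Lemma gen_rule t k i d : (t < r)%N -> (k < 7)%N -> (i < D)%N -> (d < r)%N ->
  indep t (rule k i d) -> gen t (rule k i d).
Proof.
move=> tr k7 iD dr ind; have [h sh] := shear_ex b01 tr (wr_rule k i d) ind.
by exists h => //; exists t, k, i, d; rewrite tr k7 iD dr.
Qed.

Local Notation comp t c O := (@lin_comp V B b0 b1 e r b01 gens gens_inv t c O _).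

Lemma lin_lt j : (j < 6)%N -> (lin j < r)%N.
Proof. by rewrite ltn_add2l. Qed.

Lemma alpha_toggle i t f x : (i < D)%N -> (D <= t < r)%N -> t != (D + i)%N ->
  alpha i (toggle t f x) = alpha i x.
Proof.
move=> iD /andP[Dt tr] ti; apply/funext => v; rewrite /alpha.
have bt k : (k < D)%N -> bit k (toggle t f x) = bit k x.
  by move=> kD; rewrite bit_toggle_neq //; [lia | apply/eqP; lia].
rewrite bit_toggle_neq ?bt //; last by lia.
do 3!congr (_ && _); apply: eq_in_all => k; rewrite mem_iota => kD.
by rewrite !bt //; lia.
Qed.

Lemma beta_toggle i t f x : (i < D)%N -> (D <= t < r)%N -> t != (D + i)%N ->
  beta i (toggle t f x) = beta i x.
Proof.
move=> iD /andP[Dt tr] ti; apply/funext => v; rewrite /beta.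
by rewrite bit_toggle_neq //; lia.
Qed.

Lemma fwd_toggle i t f x : (i < D)%N -> (D <= t < r)%N -> t != (D + i)%N ->
  fwd i (toggle t f x) = fwd i x.
Proof.
move=> iD tr ti; apply/funext => p; rewrite /fwd alpha_toggle // frame_toggle //.
by case/andP: tr.
Qed.

Lemma bwd_toggle i t f x : (i < D)%N -> (D <= t < r)%N -> t != (D + i)%N ->
  bwd i (toggle t f x) = bwd i x.
Proof.
move=> iD tr ti; apply/funext => p; rewrite /bwd beta_toggle // frame_toggle //.
by case/andP: tr.
Qed.

Lemma fwd_add i x : fadditive (fwd i x).
Proof.
move=> p q; apply/funext => v; rewrite /fwd /fadd.
by case: frame => //=; case: alpha.
Qed.

Lemma bwd_add i x : fadditive (bwd i x).
Proof.
move=> p q; apply/funext => v; rewrite /bwd /fadd.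
by case: frame => //=; case: beta.
Qed.

(* A certificate at level i forces the box spanned by the first i directions at v
   to consist of frames with correct face labels (cert_box).  A line is walked
   forward with the carries toggled by the previous level and back with the
   original carries, which must be clear. *)
Fixpoint cert (n i : nat) x : fld :=
  if i is j.+1 then fun v => bit j x v &&
    all (fun q => alpha j (toggle (D + j) (cert n j x) x) (v + eps j *+ q) &&
                  beta j x (v + eps j *+ q)) (iota 1 n.-1)
  else frame x.

Lemma cert_frame n i x v : cert n i x v -> frame x v.
Proof. by case: i => //= i /andP[/bit_frame]. Qed.

(** Level [i] reads only frames, face labels and carries below [D + i], so writing its outcome into
    carry [D + i] does not alter it. *)
Lemma cert_toggle n i t f x : (i <= D)%N -> (D + i <= t < r)%N ->
  cert n i (toggle t f x) = cert n i x.
Proof.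
elim: i t f x => [|i IH] t f x iD tr /=.
  by rewrite frame_toggle //; case/andP: tr.
have [tr1 tr2] := andP tr; apply/funext => v.
rewrite bit_toggle_neq ?IH //; [|lia|lia|lia|apply/eqP; lia].
rewrite toggleC //; last by lia.
rewrite alpha_toggle ?beta_toggle //; lia.
Qed.

Lemma iter_step (a : fld) w (p : fld) m v :
  iter m (fun p v => a v && p (v + w)) p v =
  all (fun q => a (v + w *+ q)) (iota 0 m) && p (v + w *+ m).
Proof.
elim: m v => [|m IH] v /=; first by rewrite addr0.
rewrite IH addr0 -andbA -addrA -mulrS (iotaDl 1 0) all_map.
congr [&& _, _ & _]; apply: eq_all => q /=.
by rewrite -addrA add1n -mulrS.
Qed.

Lemma iter_fwd i x p m v : iter m (fwd i x) p v =
  all (fun q => frame x (v - eps i *+ q) && alpha i x (v - eps i *+ q)) (iota 0 m)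
  && p (v - eps i *+ m).
Proof.
have -> : fwd i x = fun p v => (frame x v && alpha i x v) && p (v + - eps i).
  by apply/funext => p'; apply/funext => v'; rewrite -andbA.
rewrite iter_step mulNrn; congr (_ && _).
by apply: eq_all => q; rewrite mulNrn.
Qed.

Lemma iter_bwd i x p m v : iter m (bwd i x) p v =
  all (fun q => frame x (v + eps i *+ q) && beta i x (v + eps i *+ q.+1)) (iota 0 m)
  && p (v + eps i *+ m).
Proof.
have -> : bwd i x = fun p v => (frame x v && beta i x (v + eps i)) && p (v + eps i).
  by apply/funext => p'; apply/funext => v'; rewrite -andbA.
rewrite iter_step; congr (_ && _).
by apply: eq_all => q; rewrite -addrA -mulrSr.
Qed.

(** The round trip along the line has zero displacement, so [p v] returns multiplied by every guard
    met: set carries in [y] one way, clear carries in [x] the other. With the face label at [v]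
    these are the conditions of the next level. *)
Lemma cert_step n i x p v : (i < D)%N -> frame x v ->
  let y := toggle (D + i) (cert n i x) x in
  bit i x v && iter n.-1 (bwd i x) (iter n.-1 (fwd i y) p) v =
  cert n i.+1 x v && p v.
Proof.
move=> iD fv y; rewrite /= -/y -andbA; congr (_ && _); set m := n.-1.
rewrite iter_bwd iter_fwd addrK andbA; congr (_ && _).
have Dr : (D + i < r)%N by lia.
have shf q : (q <= m)%N -> v + eps i *+ m - eps i *+ q = v + eps i *+ (m - q).
  by move=> qm; rewrite mulrnBr // addrA.
apply/andP/allP => [[/allP h1 /allP h2] q|h].
  rewrite mem_iota => /andP[q1 qm].
  have /h2 : (m - q)%N \in iota 0 m by rewrite mem_iota; lia.
  rewrite shf ?subKn; [|lia|lia] => /andP[_ ->].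
  have /h1 : q.-1 \in iota 0 m by rewrite mem_iota; lia.
  by rewrite prednK // => /andP[_ ->].
have fr q : (q <= m)%N -> frame x (v + eps i *+ q).
  case: q => [|q] qm; first by rewrite addr0.
  have /h/andP[/andP[/bit_frame]] : q.+1 \in iota 1 m by rewrite mem_iota; lia.
  by rewrite frame_toggle.
split; apply/allP => q; rewrite mem_iota => /andP[_ qm].
  have /h/andP[_ ->] : q.+1 \in iota 1 m by rewrite mem_iota; lia.
  by rewrite fr //; lia.
rewrite shf; last by lia.
have /h/andP[-> _] : (m - q)%N \in iota 1 m by rewrite mem_iota; lia.
by rewrite frame_toggle // fr //; lia.
Qed.

Notation mid j := (2 <= j < 6)%N.

Lemma mid_other i j : exists2 k, mid k & (k != i) && (k != j).
Proof.
have [h|h] := boolP ((2 != i) && (2 != j))%N; first by exists 2%N.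
have [h'|h'] := boolP ((3 != i) && (3 != j))%N; first by exists 3%N.
by exists 4%N => //; lia.
Qed.

Lemma gen_lin j j' : (j < 6)%N -> (j' < 6)%N -> j != j' ->
  gen (lin j) (bit (lin j')).
Proof.
move=> j6 j'6 jj; apply: (@gen_rule (lin j) 0 0 (lin j')); rewrite ?lin_lt //.
move=> f x; rewrite /= bit_toggle_neq ?lin_lt //.
by apply: contra_neq jj; rewrite /lin; lia.
Qed.

Lemma lin_static j i : (j < 6)%N -> (i < D)%N ->
  (D <= lin j < r)%N && (lin j != D + i)%N.
Proof. by rewrite /lin; lia. Qed.

Lemma lin_iter_fwd i j j' : (i < D)%N -> mid j -> mid j' -> j != j' ->
  lin_family (lin j) (fun k x => iter (2 ^ k).-1 (fwd i x) (bit (lin j') x)).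
Proof.
move=> iD mj mj' jj.
have st q f x : (q < 6)%N -> fwd i (toggle (lin q) f x) = fwd i x.
  by move=> q6; have /andP[h1 h2] := lin_static q6 iD; rewrite fwd_toggle.
have nl p q : p != q -> lin p != lin q by rewrite /lin; lia.
apply: (@lin_run _ _ _ _ _ _ b01 _ gens_inv _ (lin 0) (lin 1)) => //;
  rewrite ?lin_lt ?nl //; try lia.
- exact: fwd_add.
- by move=> x p v; rewrite /fwd => /negPf ->.
- by move=> f x; rewrite st.
- by move=> f x; rewrite st.
- by move=> f x; rewrite st //; lia.
- apply: (@gen_rule (lin 1) 2 i (lin 0)); rewrite ?lin_lt //.
  by move=> f x /=; rewrite st // bit_toggle_neq ?lin_lt // nl.
- exact: gen_lin.
- exact: gen_lin.
- by apply: gen_lin => //; lia.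
- by apply: gen_lin => //; lia.
Qed.

Lemma lin_iter_bwd i j j' : (i < D)%N -> mid j -> mid j' -> j != j' ->
  lin_family (lin j) (fun k x => iter (2 ^ k).-1 (bwd i x) (bit (lin j') x)).
Proof.
move=> iD mj mj' jj.
have st q f x : (q < 6)%N -> bwd i (toggle (lin q) f x) = bwd i x.
  by move=> q6; have /andP[h1 h2] := lin_static q6 iD; rewrite bwd_toggle.
have nl p q : p != q -> lin p != lin q by rewrite /lin; lia.
apply: (@lin_run _ _ _ _ _ _ b01 _ gens_inv _ (lin 0) (lin 1)) => //;
  rewrite ?lin_lt ?nl //; try lia.
- exact: bwd_add.
- by move=> x p v; rewrite /bwd => /negPf ->.
- by move=> f x; rewrite st.
- by move=> f x; rewrite st.
- by move=> f x; rewrite st //; lia.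
- apply: (@gen_rule (lin 1) 3 i (lin 0)); rewrite ?lin_lt //.
  by move=> f x /=; rewrite st // bit_toggle_neq ?lin_lt // nl.
- exact: gen_lin.
- exact: gen_lin.
- by apply: gen_lin => //; lia.
- by apply: gen_lin => //; lia.
Qed.

Lemma frame_and_bit t x : (fun v => frame x v && bit t x v) = bit t x.
Proof.
by apply/funext => v; case: (boolP (bit t x v)); rewrite ?andbF // => /bit_frame ->.
Qed.

(** A commutator with the shear flipping [lin 3] on every frame replaces the factor [bit (lin 3)] by
    1; another one moves the result from [lin 2] to the carry. *)
Lemma lin_carry i : (i < D)%N ->
  lin_family (lin 2) (fun k x v => cert (2 ^ k) i x v && bit (lin 3) x v) ->
  lin_family (D + i) (fun k => cert (2 ^ k) i).
Proof.
move=> iD fam.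
have l2 : (lin 2 < r)%N by exact: lin_lt.
have l3 : (lin 3 < r)%N by exact: lin_lt.
have Dr : (D + i < r)%N by lia.
have ct k t f x : (D + i <= t < r)%N ->
    cert (2 ^ k) i (toggle t f x) = cert (2 ^ k) i x.
  by move=> tr; rewrite cert_toggle // ltnW.
have g3 : gen (lin 3) frame.
  apply: (@gen_rule (lin 3) 6 0 0); rewrite //; first by lia.
  by move=> f x; rewrite /= frame_toggle.
have aff : lin_family (lin 2) (fun k => cert (2 ^ k) i).
  have h := comp (lin 2) (lin 3) (fun k x p v => cert (2 ^ k) i x v && p v) l2 l3.
  apply: lin_ext (h _ _ _ _ _ _ _ fam (lin_gen g3)) => [k x v fv||k x p q|k f x|k f x|k f x|k f x].
  - by rewrite fv !andbT.
  - by rewrite /lin; lia.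
  - by apply/funext => v; rewrite /fadd; case: cert.
  - by rewrite ct //= /lin; lia.
  - by rewrite ct //= /lin; lia.
  - by rewrite /= frame_toggle.
  - by rewrite /= frame_toggle.
have gc : gen (D + i) (bit (lin 2)).
  apply: (@gen_rule (D + i) 0 0 (lin 2)); rewrite //.
  by move=> f x; rewrite /= bit_toggle_neq // /lin; lia.
have h := comp (D + i)%N (lin 2) (fun k x p => p) Dr l2.
apply: lin_ext (h _ _ _ _ _ _ _ (lin_gen gc) aff) => [k x v fv|||||k f x|k f x] //.
- by rewrite fv.
- by rewrite /lin; lia.
- by rewrite ct //; lia.
- by rewrite ct // /lin; lia.
Qed.

(** Induction on the level along [cert_step]: the forward walk is conjugated by the carry shear,
    then the backward walk and the face label are composed with it by commutators. Every level
    multiplies the length by a constant. *)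
Lemma lin_cert i j j' : (i <= D)%N -> mid j -> mid j' -> j != j' ->
  lin_family (lin j) (fun k x v => cert (2 ^ k) i x v && bit (lin j') x v).
Proof.
elim: i j j' => [|i IH] j j' iD mj mj' jj.
  have g : gen (lin j) (bit (lin j')) by apply: gen_lin; lia.
  by apply: lin_ext (lin_gen g) => k x v /= ->.
have carry : lin_family (D + i) (fun k => cert (2 ^ k) i).
  by apply: lin_carry => //; apply: IH => //; lia.
have nl p q : p != q -> lin p != lin q by rewrite /lin; lia.
have midr p : mid p -> (lin p < r)%N by rewrite /lin; lia.
have Dr : (D + i < r)%N by lia.
pose y k x := toggle (D + i) (cert (2 ^ k) i x) x.
have yt k p f x : mid p -> y k (toggle (lin p) f x) = toggle (lin p) f (y k x).
  move=> mp; rewrite /y cert_toggle; [|exact: ltnW|by rewrite /lin; lia].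
  by rewrite toggleC ?midr.
have fwt k p f x : mid p -> fwd i (y k (toggle (lin p) f x)) = fwd i (y k x).
  by move=> mp; rewrite yt // fwd_toggle // /lin; lia.
have bwt p f x : mid p -> bwd i (toggle (lin p) f x) = bwd i x.
  by move=> mp; rewrite bwd_toggle // /lin; lia.
have ybit k p x : mid p -> bit (lin p) (y k x) = bit (lin p) x.
  by move=> mp; rewrite bit_toggle_neq ?midr // /lin; lia.
pose psi k x := iter (2 ^ k).-1 (fwd i (y k x)) (bit (lin j') x).
have psi_ind k p : mid p -> p != j' -> indep (lin p) (psi k).
  by move=> mp pj f x; rewrite /psi fwt // bit_toggle_neq ?midr ?nl.
have psi_frame k x : (fun v => frame x v && psi k x v) = psi k x.
  apply/funext => v; rewrite /psi; case: _.-1 => [|m] /=.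
    by have /(congr1 (fun f => f v)) := frame_and_bit (lin j') x.
  by rewrite /fwd frame_toggle // andbA andbb.
have [q mq /andP[qj qj']] := mid_other j j'.
have [q1 mq1 /andP[q1q q1j']] := mid_other q j'.
(* Conjugation by the carry shear makes the forward walk read the toggled carries of [y]. *)
have famf p : mid p -> p != j' -> lin_family (lin p) psi.
  move=> mp pj; have := lin_conj b01 gens_inv (midr p mp) Dr _
    (lin_iter_fwd iD mp mj' pj) carry.
  move=> h; apply: lin_ext (h _) => [k x v _|k f x]; first by rewrite /psi ybit.
  by rewrite cert_toggle //; [exact: ltnW | rewrite /lin; lia].
have fambf : lin_family (lin q) (fun k x => iter (2 ^ k).-1 (bwd i x) (psi k x)).
  have qq1 : q != q1 by rewrite eq_sym.
  have h := comp (lin q) (lin q1) (fun k x => iter (2 ^ k).-1 (bwd i x))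
    (midr q mq) (midr q1 mq1) (nl _ _ qq1).
  apply: lin_ext (h _ _ _ _ _ _ (lin_iter_bwd iD mq mq1 qq1) (famf q1 mq1 q1j')) => [k x v fv|k x|k f x|k f x|k|k].
  - by rewrite psi_frame.
  - exact/fadditive_iter/bwd_add.
  - by rewrite bwt.
  - by rewrite bwt.
  - exact: psi_ind.
  - exact: psi_ind.
have gt : gen (lin j) (fun x v => bit i x v && bit (lin q) x v).
  apply: (@gen_rule (lin j) 1 i (lin q)); rewrite ?midr //.
  move=> f x; apply/funext => v /=; rewrite !bit_toggle_neq ?midr ?nl //.
  - by rewrite eq_sym.
  - by lia.
  - by rewrite /lin; lia.
have jq : j != q by rewrite eq_sym.
have h := comp (lin j) (lin q) (fun k x p v => bit i x v && p v)
  (midr j mj) (midr q mq) (nl _ _ jq).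
have ib p : mid p -> indep (lin p) (fun x => bit i x).
  by move=> mp f x; rewrite bit_toggle_neq ?midr //; rewrite /lin; lia.
apply: lin_ext (h _ _ _ _ _ _ (lin_gen gt) fambf) => [k x v fv|k x p1 p2|k f x|k f x|k f x|k f x].
- by rewrite -(@cert_step (2 ^ k) i x (bit (lin j') x) v iD fv) fv.
- by apply/funext => v; rewrite /fadd; case: (bit i x v).
- by rewrite (ib j mj f x).
- by rewrite (ib q mq f x).
- by rewrite bwt // psi_ind.
- by rewrite bwt // psi_ind.
Qed.



(** * The geometry of certified boxes *)

Definition corner v (u : nat -> nat) : V := v + \sum_(k < D) eps k *+ u k.

Lemma corner_sub v u k m : (k < D)%N -> (m <= u k)%N ->
  corner v u = corner v (fun i => if i == k then (u k - m)%N else u i) + eps k *+ m.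
Proof.
move=> kD mu; rewrite /corner -addrA; congr (_ + _).
rewrite (bigD1 (Ordinal kD)) //= [in RHS](bigD1 (Ordinal kD)) //= eqxx.
rewrite addrAC -mulrnDr subnK //; congr (_ + _); apply: eq_bigr => i ik.
case: eqP => // ik'; case/eqP: ik; exact: val_inj.
Qed.

(** A carry that is clear by [beta] and set after the toggle by [alpha] was toggled, so the previous
    level holds at that point. *)
Lemma cert_line n i x v : (1 < n)%N -> (i < D)%N -> cert n i.+1 x v ->
  forall q, (q < n)%N -> [/\ cert n i x (v + eps i *+ q),
    bit i x (v + eps i *+ q) = (q == 0)%N &
    forall k, (i < k < D)%N -> bit k x (v + eps i *+ q) = bit k x v].
Proof.
move=> n1 iD /= /andP[bv /allP h].
have Dr : (D + i < r)%N by lia.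
have step q : (0 < q < n)%N ->
    [/\ cert n i x (v + eps i *+ q), cert n i x (v + eps i *+ q.-1),
    ~~ bit i x (v + eps i *+ q) & forall k, (i < k < D)%N ->
    bit k x (v + eps i *+ q) = bit k x (v + eps i *+ q.-1)].
  move=> qn; have /h/andP[/and4P[c1 c2 nb /allP al] /andP[d1 d2]] :
    q \in iota 1 n.-1 by rewrite mem_iota; lia.
  have E : v + eps i *+ q - eps i = v + eps i *+ q.-1.
    by case: q qn {c1 c2 nb al d1 d2} => // q _; rewrite mulrSr addrA addrK.
  rewrite E in c2 d2.
  have bt k : (k < D)%N ->
      bit k (toggle (D + i) (cert n i x) x) = bit k x.
    by move=> kD; rewrite bit_toggle_neq //; [lia | apply/eqP; lia].
  split.
  - by move: c1; rewrite bit_toggle // (negPf d1) => /andP[].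
  - by move: c2; rewrite bit_toggle // (negPf d2) => /andP[].
  - by rewrite -bt.
  - move=> k kD; have /al : k \in iota i.+1 (D - i.+1) by rewrite mem_iota; lia.
    by rewrite E !bt ?(andP kD).2 // => /eqP.
elim=> [|q IH] qn.
  rewrite addr0; split=> //; have [|_ + _ _] := step 1%N; first by rewrite n1.
  by rewrite addr0.
have [c1 c2 nb bk] := step q.+1 qn; split=> //; first exact: negbTE.
by move=> k kD; rewrite bk //=; have [_ _ ->] := IH (ltnW qn).
Qed.

(** Direction [i] is unrolled by [cert_line], and induction treats the box based at each point of
    that line. Labels not yet checked are inherited from [v]. *)
Lemma cert_box n i x v : (1 < n)%N -> (i <= D)%N -> cert n i x v ->
  forall u : nat -> nat, (forall k, (k < D)%N -> (u k < n)%N) ->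
  (forall k, (i <= k < D)%N -> u k = 0%N) ->
  frame x (corner v u) /\ forall k, (k < D)%N ->
  bit k x (corner v u) = if (k < i)%N then u k == 0%N else bit k x v.
Proof.
move=> n1; elim: i v => [|i IH] v iD cv u un u0.
  have -> : corner v u = v.
    rewrite /corner big1 ?addr0 // => k _; rewrite u0 ?mulr0n //=.
  by split; first exact: cv.
have [cq bq kq] := cert_line n1 iD cv (un i iD).
pose u' k := if k == i then 0%N else u k.
have E : corner v u = corner (v + eps i *+ u i) u'.
  rewrite (corner_sub v iD (leqnn _)) subnn /corner -/u'.
  by rewrite -!addrA [eps i *+ _ + _]addrC.
have [|k kD|k kD|fr bk] := IH (v + eps i *+ u i) _ cq u'.
- exact: ltnW.
- by rewrite /u'; case: eqP => // _; [exact: leq_trans (ltnW n1) | exact: un].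
- by rewrite /u'; case: eqP => // ki; apply: u0; lia.
rewrite E; split=> // k kD; rewrite bk // /u' ltnS.
case: (ltngtP k i) => [ki|ik|->] //; first by rewrite kq // ik kD.
Qed.

Lemma cert_corner n x v (u : nat -> nat) : (1 < n)%N -> cert n D x v ->
  (forall k, (k < D)%N -> (u k < n)%N) ->
  frame x (corner v u) /\
  forall k, (k < D)%N -> bit k x (corner v u) = (u k == 0%N).
Proof.
move=> n1 cv un; have [|fr bk] := cert_box n1 (leqnn D) cv un; first by move=> k; lia.
by split=> // k kD; rewrite bk // kD.
Qed.

(** If [u' k < u k], going back [u' k] steps in direction [k] reaches coordinate 0 in the box of [w]
    but a positive one in the box of [v], and label [k] cannot be both set and clear. *)
Lemma cert_isolated n x v w (u u' : nat -> nat) : (1 < n)%N ->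
  cert n D x v -> cert n D x w ->
  (forall k, (k < D)%N -> (u k < n)%N /\ (u' k < n)%N) ->
  corner v u = corner w u' -> forall k, (k < D)%N -> u k = u' k.
Proof.
move=> n1; have step v' w' (s s' : nat -> nat) k : cert n D x v' -> cert n D x w' ->
    (forall k, (k < D)%N -> (s k < n)%N) -> (forall k, (k < D)%N -> (s' k < n)%N) ->
    corner v' s = corner w' s' -> (k < D)%N -> (s' k < s k)%N -> False.
  move=> cv cw sn s'n E kD lt.
  move: E; rewrite (corner_sub v' kD (ltnW lt)) (corner_sub w' kD (leqnn _)).
  move/addIr; rewrite subnn.
  set t := fun i => if i == k then (_ - _)%N else _; set t' := fun i => _ => E.
  have [|_ /(_ k kD)] := cert_corner (u := t) n1 cv.
    by move=> i iD; rewrite /t; case: eqP => // _; [have := sn k kD; lia | exact: sn].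
  have [|_ /(_ k kD)] := cert_corner (u := t') n1 cw.
    by move=> i iD; rewrite /t'; case: eqP => // _; [lia | exact: s'n].
  by rewrite E => ->; rewrite /t /t' !eqxx; lia.
move=> cv cw un E k kD; case: (ltngtP (u k) (u' k)) => // lt.
  case: (step w v u' u k) => //; by move=> i /un[].
by case: (step v w u u' k) => //; move=> i /un[].
Qed.

(** * Routes to the points of a box, numbered by their base [n] digits *)

Definition route n j : seq nat := flatten [seq nseq (digit n j k) k | k <- iota 0 D].
Definition disp (l : seq nat) : V := \sum_(i <- l) eps i.

Lemma route_lt n j : all (fun i => i < D)%N (route n j).
Proof.
apply/allP => i /flattenP[s /mapP[k]]; rewrite mem_iota => kD -> /nseqP[-> _].
by case/andP: kD.
Qed.

Lemma count_route n j k : (k < D)%N -> count_mem k (route n j) = digit n j k.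
Proof.
move=> kD; rewrite count_flatten -map_comp.
have -> : [seq (count_mem k \o (fun i => nseq (digit n j i) i)) i | i <- iota 0 D] =
    [seq (if i == k then digit n j k else 0)%N | i <- iota 0 D].
  apply: eq_map => i /=; rewrite count_nseq /=; case: eqP => [->|_]; last by rewrite mul0n.
  by rewrite mul1n.
rewrite sumnE big_map (bigD1_seq k) ?iota_uniq ?mem_iota //=.
by rewrite eqxx big1 ?addn0 // => i /negPf ->.
Qed.

Lemma disp_corner v l : all (fun i => i < D)%N l ->
  v + disp l = corner v (fun k => count_mem k l).
Proof.
rewrite /corner /disp => lD; congr (_ + _); elim: l lD => [|i l IH] /=.
  by rewrite big_nil big1 // => k _; rewrite mulr0n.
move=> /andP[iD lD]; rewrite big_cons IH //.
under [RHS]eq_bigr do rewrite mulrnDr.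
rewrite big_split /=; congr (_ + _).
rewrite (bigD1 (Ordinal iD)) //= eqxx mulr1n big1 ?addr0 // => k ki.
by rewrite (_ : (i == k) = false) ?mulr0n //; apply: contraNF ki => /eqP ik; apply/eqP/val_inj.
Qed.

Definition short n (l : seq nat) :=
  all (fun i => i < D)%N l /\ forall k, (k < D)%N -> (count_mem k l < n)%N.

Lemma route_short n j : (0 < n)%N -> short n (route n j).
Proof.
move=> n0; split; first exact: route_lt.
by move=> k kD; rewrite count_route // ltn_pmod.
Qed.

Lemma short_cat n l1 l2 : short n (l1 ++ l2) -> short n l1 /\ short n l2.
Proof.
move=> [+ lc]; rewrite all_cat => /andP[a1 a2].
by split; split=> // k kD; have := lc k kD; rewrite count_cat; lia.
Qed.

Lemma cert_disp n x v l : (1 < n)%N -> cert n D x v -> short n l -> frame x (v + disp l).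
Proof. by move=> n1 cv [lD lc]; rewrite disp_corner //; case: (cert_corner n1 cv lc). Qed.

Lemma cert_route n x v w j j' : (1 < n)%N -> (j < n ^ D)%N -> (j' < n ^ D)%N ->
  j != j' -> cert n D x v -> v + disp (route n j) = w + disp (route n j') ->
  cert n D x w = false.
Proof.
move=> n1 jn jn' jj cv; rewrite !disp_corner ?route_lt // => E; apply/negP => cw.
have n0 := ltnW n1; case/eqP: jj; apply: (digit_inj jn jn') => k kD.
rewrite -!count_route //.
apply: (cert_isolated (u := fun k => count_mem k _) (u' := fun k => count_mem k _) n1 cv cw _ E) => //.
by move=> i iD; rewrite !count_route // !ltn_pmod.
Qed.

Definition move_by (back : bool) i : V := if back then - eps i else eps i.

(** Translation along a route in steps that single generators perform. Inside a certified box every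
    frame test succeeds. *)
Fixpoint walk back (l : seq nat) x (p : fld) : fld :=
  if l is i :: l' then fun v => frame x v && walk back l' x p (v + move_by back i)
  else p.

Lemma walk_toggle back l t f x : (t < r)%N -> walk back l (toggle t f x) = walk back l x.
Proof.
move=> tr; elim: l => //= i l IH; apply/funext => p; apply/funext => v.
by rewrite frame_toggle // IH.
Qed.

Lemma walk_add back l x : fadditive (walk back l x).
Proof.
move=> p q; elim: l => //= i l IH; apply/funext => v.
by rewrite /fadd IH /fadd; case: frame.
Qed.

Lemma walk_fwd_imp l x p v : walk false l x p v -> p (v + disp l).
Proof.
elim: l v => [|i l IH] v /=; rewrite /disp ?big_nil ?addr0 // big_cons addrA.
by move=> /andP[_ /IH].
Qed.

Lemma walk_back_imp l x p v : walk true l x p v -> p (v - disp l).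
Proof.
elim: l v => [|i l IH] v /=; rewrite /disp ?big_nil ?subr0 // big_cons opprD addrA.
by move=> /andP[_ /IH].
Qed.

Lemma walk_fwd n l x p v : (1 < n)%N -> cert n D x v -> short n l ->
  walk false l x p v = p (v + disp l).
Proof.
move=> n1 cv sl; have gen l0 l1 : short n (l0 ++ l1) ->
    walk false l1 x p (v + disp l0) = p (v + disp (l0 ++ l1)).
  elim: l1 l0 => [|i l1 IH] l0 s0; first by rewrite cats0.
  rewrite /= (cert_disp n1 cv (short_cat s0).1) /=.
  rewrite -cat_rcons -IH ?cat_rcons // -addrA.
  by congr (walk _ _ _ _ (_ + _)); rewrite /disp -cats1 big_cat big_seq1.
by have := gen [::] l sl; rewrite /disp big_nil addr0.
Qed.

Lemma walk_back n l x p v : (1 < n)%N -> cert n D x v -> short n l ->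
  walk true l x p (v + disp l) = p v.
Proof.
move=> n1 cv; elim: l => [|i l IH] sl; first by rewrite /disp big_nil addr0.
rewrite /= (cert_disp n1 cv sl) /=.
rewrite -IH; last by case: (@short_cat n [:: i] l sl).
by congr (walk _ _ _ _ _); rewrite /disp big_cons [eps i + _]addrC addrA addrK.
Qed.

Lemma walk_back_cert n l x (p : fld) v : (1 < n)%N -> short n l ->
  walk true l x (fun v => cert n D x v && p v) v =
  cert n D x (v - disp l) && p (v - disp l).
Proof.
move=> n1 sl; apply/idP/idP => [/walk_back_imp//|h].
have [cv _] := andP h; rewrite -{1}(subrK (disp l) v).
by rewrite (walk_back _ n1 cv sl).
Qed.



Lemma mid_lt j : mid j -> (lin j < r)%N.
Proof. by rewrite /lin; lia. Qed.

Lemma lin_neq i j : i != j -> lin i != lin j.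
Proof. by rewrite /lin; lia. Qed.

Lemma bit_lin_toggle i j f x : mid i -> mid j -> i != j ->
  bit (lin j) (toggle (lin i) f x) = bit (lin j) x.
Proof. by move=> mi mj ij; rewrite bit_toggle_neq ?mid_lt ?lin_neq. Qed.

Lemma cert_lin_toggle n j f x : mid j ->
  cert n D (toggle (lin j) f x) = cert n D x.
Proof. by move=> mj; rewrite cert_toggle // mid_lt // andbT /lin; lia. Qed.

(** One commutator per step of the route. Only membership is recorded, as nonempty routes occur only
    in [b j] and [c j] with [j != 0], whose length is not bounded. *)
Lemma walk_elem back l j j' : all (fun i => i < D)%N l -> mid j -> mid j' -> j != j' ->
  exists2 g, generated gens g &
    shear_of g (lin j) (fun x => walk back l x (bit (lin j') x)).
Proof.
elim: l j j' => [|i l IH] j j' /= lD mj mj' jj.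
  have [||//|g Sg sg] := @gen_lin j j'; try lia.
  by exists g => //; exact: generated_gen.
have [iD lD'] := andP lD.
have [q mq /andP[qj qj']] := mid_other j j'.
have jq : j != q by rewrite eq_sym.
have [h gh sh] := IH q j' lD' mq mj' qj'.
have [g Sg sg] : gen (lin j) (fun x v => frame x v && bit (lin q) x (v + move_by back i)).
  have ind : indep (lin j) (fun x v => frame x v && bit (lin q) x (v + move_by back i)).
    move=> f x; apply/funext => v.
    by rewrite frame_toggle ?mid_lt // bit_lin_toggle.
  by case: back ind {IH sh} => ind;
    [apply: (@gen_rule (lin j) 5 i (lin q))
    |apply: (@gen_rule (lin j) 4 i (lin q))]; rewrite ?mid_lt.
exists [~ g, h]%g; first by apply: generatedR => //; exact: generated_gen.
pose O x (p : fld) : fld := fun v => frame x v && p (v + move_by back i).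
have := @shear_comp _ _ _ _ _ _ b01 g h (lin j) (lin q) O _ (mid_lt mj) (mid_lt mq)
  (lin_neq jq) _ _ _ _ _ sg sh.
move=> H; apply: shear_ext (H _ _ _ _ _) => [x v fv|x p1 p2|f x|f x|f x|f x].
- rewrite /O fv /=; case: l {IH lD lD' sh H} => [|i' l] /=; last by rewrite andbA andbb.
  by case: (boolP (bit _ _ _)) => [/bit_frame ->|]; rewrite ?andbF.
- by apply/funext => v; rewrite /O /fadd; case: frame.
- by rewrite /O frame_toggle ?mid_lt.
- by rewrite /O frame_toggle ?mid_lt.
- by rewrite walk_toggle ?mid_lt // bit_lin_toggle.
- by rewrite walk_toggle ?mid_lt // bit_lin_toggle.
Qed.

Lemma route0 n : route n 0 = [::].
Proof.
rewrite /route; elim: (iota 0 D) => //= k l ->.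
by rewrite /digit div0n mod0n.
Qed.

(** * The Heisenberg system at one scale *)

Section Level.
Variables (n : nat) (a e' : G) (b c : nat -> G).
Hypothesis n_gt1 : (1 < n)%N.
Let N := (n ^ D)%N.
Let dl j : V := disp (route n j).
Let f j := [~ a, b j]%g.
Let g j := [~ c j, e']%g.
Let vv j := [~ b j, g j]%g.
Let s := cert n D.
Hypothesis sa : shear_of a (lin 2) (fun x v => s x v && bit (lin 3) x v).
Hypothesis se : shear_of e' (lin 5) frame.
Hypothesis sb : forall j,
  shear_of (b j) (lin 3) (fun x => walk false (route n j) x (bit (lin 4) x)).
Hypothesis sc : forall j, shear_of (c j) (lin 4)
  (fun x v => s x (v - dl j) && bit (lin 5) x (v - dl j)).

Let st := cert_lin_toggle n.
Let rs j : short n (route n j).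
Proof. by apply: route_short; exact: ltnW. Qed.

Lemma shear_f j : shear_of (f j) (lin 2) (fun x v => s x v && bit (lin 4) x (v + dl j)).
Proof.
have := @shear_comp _ _ _ _ _ _ b01 _ _ (lin 2) (lin 3)
  (fun x p v => s x v && p v) _ (@mid_lt 2 isT) (@mid_lt 3 isT) (@lin_neq 2 3 isT) _ _ _ _ _ sa (sb j).
move=> H; apply: shear_ext (H _ _ _ _ _) => [x v fv|x p q|k x|k x|k x|k x].
- rewrite fv /=; have [sv|//] := boolP (s x v).
  by rewrite /= (walk_fwd _ n_gt1 sv).
- by apply/funext => v; rewrite /fadd; case: (s x v).
- by rewrite /s st.
- by rewrite /s st.
- by rewrite walk_toggle ?mid_lt // bit_lin_toggle.
- by rewrite walk_toggle ?mid_lt // bit_lin_toggle.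
Qed.

Lemma shear_g j : shear_of (g j) (lin 4) (fun x v => s x (v - dl j)).
Proof.
have := @shear_comp _ _ _ _ _ _ b01 _ _ (lin 4) (lin 5)
  (fun x p v => s x (v - dl j) && p (v - dl j)) _ (@mid_lt 4 isT) (@mid_lt 5 isT)
  (@lin_neq 4 5 isT) _ _ _ _ _ (sc j) se.
move=> H; apply: shear_ext (H _ _ _ _ _) => [x v fv|x p q|k x|k x|k x|k x].
- by case: (boolP (s x (v - dl j))) => //= /cert_frame ->.
- by apply/funext => v; rewrite /fadd; case: (s x _).
- by rewrite /s st.
- by rewrite /s st.
- by rewrite frame_toggle ?mid_lt.
- by rewrite frame_toggle ?mid_lt.
Qed.

(** The displacements of [b j] and [g j] cancel, so the rule is the same for all [j]. *)
Lemma shear_v j : shear_of (vv j) (lin 3) s.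
Proof.
have := @shear_comp _ _ _ _ _ _ b01 _ _ (lin 3) (lin 4)
  (fun x => walk false (route n j) x) _ (@mid_lt 3 isT) (@mid_lt 4 isT)
  (@lin_neq 3 4 isT) _ _ _ _ _ (sb j) (shear_g j).
move=> H; apply: shear_ext (H _ _ _ _ _) => [x v fv|x p q|k x|k x|k x|k x].
- apply/idP/idP => [/walk_fwd_imp/andP[_]|sv]; first by rewrite addrK.
  rewrite (walk_fwd _ n_gt1 sv) // addrK sv andbT.
  exact: (cert_disp n_gt1 sv).
- by rewrite walk_add.
- by rewrite walk_toggle ?mid_lt.
- by rewrite walk_toggle ?mid_lt.
- by rewrite /s st.
- by rewrite /s st.
Qed.

Lemma shear_kappa : shear_of [~ a, vv 0]%g (lin 2) s.
Proof.
have := @shear_comp _ _ _ _ _ _ b01 _ _ (lin 2) (lin 3)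
  (fun x p v => s x v && p v) _ (@mid_lt 2 isT) (@mid_lt 3 isT)
  (@lin_neq 2 3 isT) _ _ _ _ _ sa (shear_v 0).
move=> H; apply: shear_ext (H _ _ _ _ _) => [x v fv|x p q|k x|k x|k x|k x].
- by rewrite fv andbb.
- by apply/funext => v; rewrite /fadd; case: (s x v).
- by rewrite /s st.
- by rewrite /s st.
- by rewrite /s st.
- by rewrite /s st.
Qed.

Lemma commute_shared i : [/\ commute a (f i), commute a (g i),
    commute e' (g i), commute e' (f i) & vv i = vv 0%N].
Proof.
have C := @shear_commute V B b0 b1 e r b01.
split.
- apply: C (@mid_lt 2 isT) (@mid_lt 2 isT) sa (shear_f i) _ _ => x v _;
  by rewrite /s st ?bit_lin_toggle.
- apply: C (@mid_lt 2 isT) (@mid_lt 4 isT) sa (shear_g i) _ _ => x v _;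
  by rewrite /s st ?bit_lin_toggle.
- apply: C (@mid_lt 5 isT) (@mid_lt 4 isT) se (shear_g i) _ _ => x v _;
  by rewrite ?frame_toggle ?mid_lt // /s st.
- apply: C (@mid_lt 5 isT) (@mid_lt 2 isT) se (shear_f i) _ _ => x v _;
  by rewrite ?frame_toggle ?mid_lt // /s st // bit_lin_toggle.
- exact: shear_uniq (shear_v i) (shear_v 0).
Qed.

(** For [i != j], [f i] reads track 4 at the [i]-th point of a certified box while [c j] writes it
    only at [j]-th points; [cert_route] keeps these apart. *)
Lemma commute_indexed i j : (i < N)%N -> (j < N)%N ->
  [/\ commute (b j) (f i), commute (c j) (g i) & i != j -> commute (c j) (f i)].
Proof.
move=> iN jN; have C := @shear_commute V B b0 b1 e r b01.
split=> [||ij].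
- apply: C (@mid_lt 3 isT) (@mid_lt 2 isT) (sb j) (shear_f i) _ _ => x v _.
    by rewrite walk_toggle ?mid_lt // bit_lin_toggle.
  by rewrite /s st // bit_lin_toggle.
- apply: C (@mid_lt 4 isT) (@mid_lt 4 isT) (sc j) (shear_g i) _ _ => x v _;
  by rewrite /s st ?bit_lin_toggle.
apply: C (@mid_lt 4 isT) (@mid_lt 2 isT) (sc j) (shear_f i) _ _ => x v _.
  by rewrite /s st // bit_lin_toggle.
rewrite {1}/s st // -/s; have [sv|//] := boolP (s x v).
rewrite /= bit_toggle ?mid_lt //.
rewrite [s x (_ - _)](cert_route n_gt1 iN jN ij sv) ?andbF ?addbF //.
by rewrite subrK.
Qed.

(** The shear adding track 2 to track 3 detects the flip of track 2 at a certified corner. *)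
Lemma kappa_noncentral : (exists x, s x 0) -> ~ center G [~ a, vv 0]%g.
Proof.
move=> [x sx] ck.
have [h _ sh] : gen (lin 3) (bit (lin 2)) by exact: gen_lin.
pose k : G := [~ a, vv 0]%g.
have E := congr1 (fun k : G => bit (lin 3) (k x) 0) (ck h).
change (bit (lin 3) (k (h x)) 0 = bit (lin 3) (h (k x)) 0) in E.
have sk : shear_of k (lin 2) s := shear_kappa.
have fx : frame x 0 := cert_frame sx.
move: E; rewrite sk bit_lin_toggle // !sh bit_toggle ?mid_lt // sk.
rewrite bit_toggle ?mid_lt // bit_lin_toggle // frame_toggle ?mid_lt //.
rewrite bit_toggle ?mid_lt // fx sx /=.
by case: (bit _ _ _); case: (bit _ _ _).
Qed.

End Level.

Lemma heisenberg_family : exists C, forall k, (0 < k)%N ->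
  (exists x, cert (2 ^ k) D x 0) ->
  exists (a e' : G) (b c : nat -> G),
  let L := (C * 2 ^ k)%N in let N := ((2 ^ k) ^ D)%N in
  let f j := [~ a, b j]%g in let g j := [~ c j, e']%g in
  let v j := [~ b j, g j]%g in
  [/\ forall j, (j < N)%N -> generated gens (b j) /\ generated gens (c j),
   [/\ word_ball gens L a, word_ball gens L e', word_ball gens L (b 0%N)
     & word_ball gens L (c 0%N)],
   forall i, (i < N)%N -> [/\ commute a (f i), commute a (g i),
    commute e' (g i), commute e' (f i) & v i = v 0%N],
   forall i j, (i < N)%N -> (j < N)%N ->
    [/\ commute (b j) (f i), commute (c j) (g i) & i != j -> commute (c j) (f i)]
   & ~ center G [~ a, v 0%N]%g].
Proof.
have lc := @lin_cert D.
have [C1 P1] := lc 2%N 3%N (leqnn _) isT isT isT.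
have [C2 P2] := lc 4%N 5%N (leqnn _) isT isT isT.
exists (C1 + C2).+1 => k k0 wit; set n := (2 ^ k)%N.
have n1 : (1 < n)%N by rewrite -(expn0 2) ltn_exp2l.
have mono (M : nat) g : (M <= (C1 + C2).+1)%N -> word_ball gens (M * n) g ->
    word_ball gens ((C1 + C2).+1 * n) g.
  by move=> MC; apply: word_ball_mono; rewrite leq_mul2r MC orbT.
have monog g : gens g -> word_ball gens ((C1 + C2).+1 * n) g.
  by move=> Sg; apply: word_ball_mono (word_ball_gen Sg); rewrite muln_gt0 /= ltnW.
have [a wa sa] := P1 k; have [c0 wc0 sc0] := P2 k; rewrite -/n in wa sa wc0 sc0.
have [e' Se se] : gen (lin 5) frame.
  apply: (@gen_rule (lin 5) 6 0 0) => //; [by rewrite mid_lt | by lia |].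
  by move=> p x; rewrite /= frame_toggle ?mid_lt.
have [b0' Sb0 sb0] : gen (lin 3) (bit (lin 4)) by exact: gen_lin.
have rs j : short n (route n j) by apply: route_short; exact: ltnW.
have /choice[b bP] : forall j, exists g, generated gens g /\
    shear_of g (lin 3) (fun x => walk false (route n j) x (bit (lin 4) x)).
  move=> j; have [g] := @walk_elem false (route n j) 3 4 (route_lt _ _) isT isT isT.
  by exists g.
have /choice[c cP] : forall j, exists g, generated gens g /\
    shear_of g (lin 4) (fun x v => cert n D x (v - disp (route n j)) &&
       bit (lin 5) x (v - disp (route n j))).
  move=> j; have [g gg sg] := @walk_elem true (route n j) 4 2 (route_lt _ _) isT isT isT.
  have [C3 P3] := lc 2%N 5%N (leqnn _) isT isT isT.
  have [h wh sh] := P3 k; rewrite -/n in sh.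
  exists [~ g, h]%g; split; first by apply: generatedR gg (word_ball_generated wh).
  have := @shear_comp _ _ _ _ _ _ b01 _ _ (lin 4) (lin 2)
    (fun x => walk true (route n j) x) _ (@mid_lt 4 isT) (@mid_lt 2 isT)
    (@lin_neq 4 2 isT) _ _ _ _ _ sg sh.
  move=> H; apply: shear_ext (H _ _ _ _ _) => [x v fv|x p q|p x|p x|p x|p x].
  - rewrite -(walk_back_cert x (bit (lin 5) x) v n1 (rs j)); congr (walk _ _ _ _ _).
    apply/funext => w; rewrite andbA; congr (_ && _).
    by case: (boolP (cert n D x w)); rewrite ?andbF // => /cert_frame ->.
  - by rewrite walk_add.
  - by rewrite walk_toggle ?mid_lt.
  - by rewrite walk_toggle ?mid_lt.
  - by rewrite cert_lin_toggle // bit_lin_toggle.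
  - by rewrite cert_lin_toggle // bit_lin_toggle.
(* Index 0 has the empty route, so [b 0] is a generator and [c 0] belongs to the linear family: both
   are short. *)
have b0E : b 0%N = b0' by apply: shear_uniq sb0; have [_] := bP 0%N; rewrite route0.
have c0E : c 0%N = c0.
  apply: shear_uniq sc0; have [_] := cP 0%N; apply: shear_ext => x v _.
  by rewrite route0 /disp big_nil subr0.
have sb j := (bP j).2; have sc j := (cP j).2.
exists a, e', b, c => L N f g v; split.
- by move=> j _; split; [have [] := bP j | have [] := cP j].
- split; [by apply: mono wa; lia | exact: monog | by rewrite b0E; exact: monog |].
  by rewrite c0E; apply: mono wc0; lia.
- by move=> i _; exact: commute_shared n1 sa se sb sc i.
- by move=> i j iN jN; exact: commute_indexed n1 sa se sb sc i j iN jN.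
- exact: kappa_noncentral n1 sa se sb sc wit.
Qed.

(** Clear carries give [beta], and the certificates of the previous level toggle exactly the carries
    that [alpha] wants set. *)
Lemma cert_witness n x (u : nat -> nat) i : (1 < n)%N -> (i <= D)%N ->
  (forall u : nat -> nat, (forall k, (k < D)%N -> (u k < n)%N) ->
    frame x (corner 0 u) /\ forall k, (k < D)%N ->
    bit k x (corner 0 u) = (u k == 0%N) /\
    bit (D + k) x (corner 0 u) = false) ->
  (forall k, (k < D)%N -> (u k < n)%N) -> (forall k, (k < i)%N -> u k = 0%N) ->
  cert n i x (corner 0 u).
Proof.
move=> n1 iD box; elim: i u iD => [|i IH] u iD un u0; first by have [] := box u un.
have [_ bu] := box u un.
rewrite /= (bu i iD).1 u0 ?ltnSn //=; apply/allP => q; rewrite mem_iota => qn.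
pose ut t k := if k == i then t else u k.
have utn t : (t < n)%N -> forall k, (k < D)%N -> (ut t k < n)%N.
  by move=> tn k kD; rewrite /ut; case: eqP => // _; exact: un.
have E t : corner 0 u + eps i *+ t = corner 0 (ut t).
  rewrite [RHS](@corner_sub 0 (ut t) i t iD); last by rewrite /ut eqxx.
  congr (_ + _); rewrite /corner; congr (_ + _); apply: eq_bigr => k _.
  congr (_ *+ _); rewrite /ut eqxx subnn; case: eqP => // ki.
  by rewrite ki u0.
have E' : corner 0 (ut q) - eps i = corner 0 (ut q.-1).
  by rewrite -!E; case: q qn => // q _; rewrite mulrSr addrA addrK.
have Dr : (D + i < r)%N by lia.
have cu t : (t < n)%N -> cert n i x (corner 0 (ut t)).
  move=> tn; apply: IH; [exact: ltnW | exact: utn |].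
  by move=> k ki; rewrite /ut; case: eqP => [kE|_]; [lia | apply: u0; lia].
have qn' : (q < n)%N by lia.
have q1n : (q.-1 < n)%N by lia.
have [fq bq] := box _ (utn q qn'); have [fq1 bq1] := box _ (utn q.-1 q1n).
have bt k y f : (k < D)%N -> bit k (toggle (D + i) f y) = bit k y.
  by move=> kD; rewrite bit_toggle_neq //; [lia | apply/eqP; lia].
rewrite E /alpha /beta E' !bit_toggle // !cu // fq fq1 !(bq i iD).2 !(bq1 i iD).2 /=.
rewrite andbT bt // (bq i iD).1 /ut eqxx -lt0n (_ : (0 < q)%N) /=; last by lia.
apply/allP => k; rewrite mem_iota => kD; have kD' : (k < D)%N by lia.
rewrite !bt // (bq k kD').1 (bq1 k kD').1 /ut.
by have -> : (k == i) = false by lia.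
Qed.

End Construction.

(** * A certified configuration *)

Section Witness.
Local Open Scope ring_scope.
Variables (D : nat) (B : finType) (b0 b1 : B).
Hypothesis b01 : b0 != b1.
Hypothesis D_gt0 : (0 < D)%N.
Notation V := 'rV[int]_D.
Notation r := (D.*2 + 6)%N.
Notation len := (r.*2 + 3)%N.

Definition unit_vec (i : nat) : V := \row_(k < D) ((k == i :> nat)%:R).
(** Frames extend along direction 0, so a box step in that direction skips a whole frame. *)
Definition cell_step (i : nat) : V := unit_vec i *+ (if i == 0%N then len else 1%N).

Definition coord (w : V) (k : nat) : int := oapp (w ord0) 0 (insub k : option 'I_D).
Definition box_coord (w : V) (k : nat) : int :=
  if k == 0%N then (coord w 0 %/ len)%Z else coord w k.

(** Frames tile every line in direction 0, with face labels set on the coordinate hyperplanes and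
    all other bits, carries included, clear. *)
Definition box_config : config V B := fun w =>
  let j := absz (coord w 0 %% len)%Z in
  if (j < 2)%N then b0
  else if odd j then
    let t := (j - 3)./2 in if (t < D)%N && (box_coord w t == 0) then b1 else b0
  else b1.

Notation pt u := (corner D cell_step 0 u).

Lemma coord_cell (u : nat -> nat) j k : (k < D)%N ->
  coord (pt u + unit_vec 0 *+ j) k =
  Posz (if k == 0%N then len * u 0%N + j else u k)%N.
Proof.
move=> kD; rewrite /coord insubT /= /corner add0r mxE mulmxnE !mxE summxE.
rewrite (bigD1 (Ordinal kD)) //= big1 => [|i ik]; last first.
  rewrite !mulmxnE !mxE /= (_ : (k == i) = false) ?mul0rn //.
  by apply: contraNF ik => /eqP E; apply/eqP/val_inj.
rewrite !mulmxnE !mxE /= eqxx addr0; case: eqP => [->|k0] /=.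
  by rewrite -mulrnA !natz; lia.
by rewrite mulr1n mul0rn addr0 -[RHS]natz.
Qed.

Lemma box_config_cell (u : nat -> nat) j : (j < len)%N ->
  box_config (pt u + unit_vec 0 *+ j) =
  if (j < 2)%N then b0
  else if odd j then
    let t := (j - 3)./2 in if (t < D)%N && (u t == 0%N) then b1 else b0
  else b1.
Proof.
move=> jl; rewrite /box_config.
have c0 := @coord_cell u j 0 D_gt0; rewrite /= in c0.
have m0 : (coord (pt u + unit_vec 0 *+ j) 0 %% len)%Z = j.
  by rewrite c0 modz_nat mulnC modnMDl modn_small.
rewrite m0 /=; case: ltnP => // j2; case: (odd j) => //.
case: ltnP => //= tD; congr (if _ then _ else _).
rewrite /box_coord; have [t0|t0] := eqVneq ((j - 3)./2) 0%N.
  have len0 : (0 < len)%N by lia.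
  by rewrite t0 c0 divz_nat mulnC divnMDl ?len0 // divn_small // addn0.
by rewrite coord_cell // (negPf t0).
Qed.

Lemma box_config_cert n : (1 < n)%N ->
  cert b0 b1 (unit_vec 0) D cell_step n D box_config 0.
Proof.
move=> n1; have -> : 0 = pt (fun _ => 0%N).
  by rewrite /corner big1 ?addr0 // => k _; rewrite mulr0n.
apply: cert_witness => //; last by move=> k _; exact: ltnW.
move=> u un; have fr : frame b0 b1 (unit_vec 0) r box_config (pt u).
  apply/frameP => j jl; rewrite box_config_cell // /fchar.
  case: ltnP => // _; case: (odd j); last by [].
  by case: ifP; rewrite eqxx ?orbT.
have bE k : (k < r)%N -> bit b0 b1 (unit_vec 0) r k box_config (pt u) =
    (k < D)%N && (u k == 0%N).
  move=> kr; rewrite /bit fr /bitpos box_config_cell /=; last by lia.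
  rewrite (_ : (_ < 2)%N = false); last by lia.
  rewrite (_ : odd _ = true); last by lia.
  rewrite addnK doubleK; case: ifP; rewrite ?eqxx //.
  by rewrite (negPf b01).
split=> // k kD; rewrite !bE ?kD; [|lia|lia]; split=> //.
by rewrite ltnNge leq_addr.
Qed.

End Witness.

(** * Comparison of growth rates and conclusion *)

Lemma polynomial_gap d D q C : (0 < d)%N -> (d < D)%N -> exists2 k, (0 < k)%N &
  (q ^ ((C * 2 ^ k).*2.+1 ^ d) < 2 ^ ((2 ^ k) ^ D))%N.
Proof.
move=> d0 dD; set M := (q * (C.*2.+1) ^ d)%N.
(* This scale makes [n > M], so the exponent [q * X <= M * n ^ d] stays below
   [n ^ d.+1 <= n ^ D]. *)
exists M.+1 => //; set n := (2 ^ M.+1)%N.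
have Mn : (M < n)%N by apply: leq_trans (ltn_expl _ _).
have n0 : (0 < n)%N by apply: leq_ltn_trans Mn.
set X := ((C * n).*2.+1 ^ d)%N.
have XM : (X <= C.*2.+1 ^ d * n ^ d)%N by rewrite -expnMn leq_exp2r //; nia.
have qX : (q ^ X <= 2 ^ (q * X))%N.
  rewrite expnM; case: (posnP X) => [->//|X0].
  by rewrite leq_exp2r // ltnW // ltn_expl.
apply: leq_ltn_trans qX _; rewrite ltn_exp2l //.
apply: leq_ltn_trans (leq_mul (leqnn q) XM) _.
apply: (@leq_trans (n ^ d.+1)); last by rewrite leq_pexp2l.
by rewrite mulnA -/M expnS ltn_pmul2r // expn_gt0 n0.
Qed.

Theorem theorem7 (d D : nat) (A B : finType)
    (d_gt0 : 0 < d) (d_lt_D : d < D) (A_nt : 1 < #|A|) (B_nt : 1 < #|B|) :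
  exists GG : set (AutShift 'rV[int]_D B),
    fg_subgroup GG /\
    forall (K : centralSubgroup (AutShift 'rV[int]_D B))
           (K' : centralSubgroup (AutShift 'rV[int]_d A)),
      ~ embeds (quotient_group K') (image GG (coset K)).
Proof.
have D_gt0 : (0 < D)%N by exact: leq_ltn_trans d_lt_D.
have /card_gt1P[b0 [b1 [_ _ b01]]] := B_nt.
pose S := @gens 'rV[int]_D B b0 b1 (unit_vec D 0) D (cell_step D).
exists (generated S); split; first by exists S => //; exact: finite_gens.
move=> K K' [phi [phiM phi_inj]].
have finS : finite_set S by exact: finite_gens.
have [q obs] := obstruction finS phiM phi_inj.
have [C fam] := heisenberg_family (unit_vec D 0) (cell_step D) b01 D_gt0.
(* The scale is chosen last, after [q] from the supposed embedding and [C] from the word lengths. *)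
have [k k0 gap] := polynomial_gap #|A| (q * C) d_gt0 d_lt_D.
have n1 : (1 < 2 ^ k)%N by rewrite -(expn0 2) ltn_exp2l.
have [|a [e' [b [c [gbc [wa we wb wc] rel1 rel2 ncen]]]]] := fam k k0.
  by exists (@box_config D B b0 b1); exact: box_config_cert.
have N1 : (1 < (2 ^ k) ^ D)%N by rewrite -expnM -(expn0 2) ltn_exp2l // muln_gt0 k0.
have := obs _ _ a e' b c N1 gbc wa we wb wc rel1 rel2 ncen.
by rewrite mulnA leqNgt gap.
Qed.
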